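(* There exist two universal constants $C,c>0$ such that the following holds. Let $D\subset\mathbb{R}^d$ be a measurable set, let $\varrho_D$ be a measure on $D$, and let $H(K)$ be a separable, infinite-dimensional reproducing kernel Hilbert space of complex-valued functions on $D$ with a positive semidefinite (Hermitian) kernel $K:D\times D\to\mathbb{C}$ satisfying $$\int_D K(\mathbf{x},\mathbf{x})\,d\varrho_D(\mathbf{x})<\infty .$$ Then the embedding $\mathrm{Id}_{K,\varrho_D}:H(K)\to L_2(D,\varrho_D)$ is a Hilbert-Schmidt operator, and the corresponding sequence of singular numbers $(\sigma_k)_{k=1}^\infty$ is square-summable. Moreover, the sampling numbers $g_n:=g_n(\mathrm{Id}_{K,\varrho_D})$ satisfy $$g_n^2\;\leq\; C\,\frac{\log n}{n}\sum_{k\geq cn}\sigma_k^2\qquad\text{for all } n\geq 2 .$$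
   Context: $L_2(D,\varrho_D)$ is the space of (equivalence classes of) complex-valued functions on $D$ that are square-integrable with respect to $\varrho_D$. $\mathrm{Id}_{K,\varrho_D}:H(K)\to L_2(D,\varrho_D)$ maps a function to its equivalence class (it need not be injective). Singular numbers: let $\lambda_1\geq\lambda_2\geq\cdots>0$ be the (at most countable) system of strictly positive eigenvalues, counted with multiplicity and arranged in non-increasing order, of $W_{K,\varrho_D}=\mathrm{Id}_{K,\varrho_D}^{*}\circ\mathrm{Id}_{K,\varrho_D}$; then $\sigma_k:=\sqrt{\lambda_k}$ (with $\sigma_k:=0$ if there are fewer than $k$ positive eigenvalues). The sum $\sum_{k\ge cn}$ runs over natural numbers $k\geq 1$ with $k\ge cn$. Sampling numbers: $$g_n(\mathrm{Id}_{K,\varrho_D}) := \inf_{\mathbf{x}^1,\dots,\mathbf{x}^n\in D}\ \inf_{\varphi:\mathbb{C}^n\to L_2(D,\varrho_D)}\ \sup_{\|f\|_{H(K)}\leq 1}\big\|f-\varphi(f(\mathbf{x}^1),\dots,f(\mathbf{x}^n))\big\|_{L_2(D,\varrho_D)},$$ where $\varphi$ ranges over all maps. ''Universal'' means that $C,c$ do not depend on $d,D,\varrho_D,K$ or $n$. $\log$ is the natural logarithm. *)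

(* Defs.v *)
From HB Require Import structures.
From mathcomp Require Import all_boot all_order all_algebra sesquilinear.
From mathcomp Require Import all_classical all_reals all_analysis.
From mathcomp Require Import complex.

Set Implicit Arguments.
Unset Strict Implicit.
Unset Printing Implicit Defensive.

Import Order.TTheory GRing.Theory Num.Theory.
Import numFieldNormedType.Exports.

Local Open Scope classical_set_scope.
Local Open Scope complex_scope.
Local Open Scope ring_scope.

Section hilbert.
Context {R : realType} {H : completeNormedModType R[i]}.
Implicit Types (dot : {dot H for Num.conj}) (S E : set H).

(* [completeNormedModType] already provides completeness; this makes [H],
   with the inner product [dot] (linear on the left), a Hilbert space. *)
Definition hilbert dot := forall f : H, `|f| ^+ 2 = dot f f.

Definition separable_space := exists S, countable S /\ dense S.

Definition has_dim S (m : nat) := exists b : 'I_m -> H,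
  (forall a : 'I_m -> R[i],
     \sum_(i < m) a i *: b i = 0 -> forall i, a i = 0) /\
  S = [set \sum_(i < m) a i *: b i | a in [set: 'I_m -> R[i]]].

Definition infinite_dim := forall m, ~ has_dim [set: H] m.

Definition orthonormal_basis dot E :=
  (forall e e', E e -> E e' -> dot e e' = (e == e')%:R) /\
  (forall f, (forall e, E e -> dot f e = 0) -> f = 0).

Definition eigenspace (W : H -> H) (lambda : R) :=
  [set f | W f = lambda%:C *: f].

(* [sigma j] is the (j+1)-st singular number: the squares of the nonzero
   terms list the positive eigenvalues of [W], in non-increasing order, each
   occurring as often as its multiplicity.  If [W] has only N positive
   eigenvalues, then the terms of index j >= N are 0. *)
Definition singular_numbers_of (W : H -> H) (sigma : nat -> R) :=
  [/\ forall j, 0 <= sigma j,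
      nonincreasing_seq sigma &
      forall lambda, 0 < lambda -> exists m,
        has_dim (eigenspace W lambda) m /\
        ([set j | sigma j ^+ 2 = lambda] #= `I_m)%card].

End hilbert.

Arguments separable_space {R} H.
Arguments infinite_dim {R} H.

(* Throughout, functions on [D] are represented by total functions on the
   ambient space [T], of which only the values on [D] are ever used, and a
   measure on [D] by a measure [mu] on [T], of which only the values on
   measurable subsets of [D] are ever used.  Elements of L_2(D, mu) are given
   by representatives. *)
Section L2.
Context {R : realType} {d : measure_display} {T : measurableType d}.
Variables (D : set T) (mu : {measure set T -> \bar R}).
Implicit Types f g : T -> R[i].

Definition cmeasurable f :=
  measurable_fun D (fun x => complex.Re (f x)) /\
  measurable_fun D (fun x => complex.Im (f x)).

Definition L2norm f : \bar R :=
  ((\int[mu]_(x in D) (complex.Re `|f x| ^+ 2)%:E) `^ 2^-1)%E.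

Definition L2fun f := cmeasurable f /\ (L2norm f < +oo)%E.

Definition L2dot f g : R[i] :=
  (\int[mu]_(x in D) complex.Re (f x * Num.conj (g x)))
  +i* (\int[mu]_(x in D) complex.Im (f x * Num.conj (g x))).

End L2.

Section rkhs.
Context {R : realType} {d : measure_display} {T : measurableType d}.
Variable D : set T.

Definition psd_kernel (K : T -> T -> R[i]) :=
  (forall x y, D x -> D y -> K y x = Num.conj (K x y)) /\
  (forall n (x : 'I_n -> T) (a : 'I_n -> R[i]), (forall i, D (x i)) ->
     0 <= \sum_(i < n) \sum_(j < n) Num.conj (a i) * a j * K (x i) (x j)).

Context {H : completeNormedModType R[i]}.
Variables (dot : {dot H for Num.conj}) (ev : {linear H -> (T -> R[i])}).

(* [ev f] is [f] as a function; the second clause says that the elements of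
   [H] are determined by their values on [D], i.e., are functions on [D]. *)
Definition rkhs (K : T -> T -> R[i]) :=
  [/\ hilbert dot,
      forall f, (forall x, D x -> ev f x = 0) -> f = 0 &
      forall y, D y -> exists k : H,
        (forall x, D x -> ev k x = K x y) /\ (forall f, ev f y = dot f k)].

Variable mu : {measure set T -> \bar R}.

(* For the operator Id : H -> L_2(D, mu), f |-> class of [ev f]. *)
Definition Id_hilbert_schmidt :=
  [/\ forall f, L2fun D mu (ev f),
      exists M : R, forall f,
        (L2norm D mu (ev f) <= (M * complex.Re `|f|)%:E)%E &
      exists E : set H, orthonormal_basis dot E /\
        (\esum_(e in E) (L2norm D mu (ev e) ^+ 2) < +oo)%E].

(* The vector representing f |-> <Id f, u>; it exists for [u] in L_2 as soon
   as Id is bounded, and is unique ([xget 0] is the definite description). *)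
Definition Id_adjoint (u : T -> R[i]) : H :=
  xget 0 [set h | forall f, dot f h = L2dot D mu (ev f) u].

Definition Id_singular_numbers (sigma : nat -> R) :=
  singular_numbers_of (fun f => Id_adjoint (ev f)) sigma.

Definition sampling_number (n : nat) : \bar R :=
  ereal_inf [set
    ereal_inf [set
      ereal_sup [set
        L2norm D mu (fun z => ev f z - phi (\row_(i < n) ev f (x i)) z)
      | f in [set f : H | `|f| <= 1]]
    | phi in [set phi : 'rV[R[i]]_n -> T -> R[i] |
                forall v, L2fun D mu (phi v)]]
  | x in [set x : 'I_n -> T | forall i, D (x i)]].

End rkhs.

(* Main.v *)
(** The points are chosen greedily, following the lower barrier argument of
    Batson, Spielman and Srivastava.  Let [q] be the inner product of L_2, seen
    as a form on H(K), and let S be the space of functions that vanish at the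
    points chosen so far.  With lambda_j the eigenvalues of [q] on S, follow the
    potential Phi_l(S) = sum_j lambda_j / (eps - l lambda_j) while l increases
    from -1 to 1 in n steps of length 2/n.  Increasing l raises the potential;
    imposing f(x) = 0 lowers it by q(g,g)/G(g,g), where g represents evaluation
    at x in the form G = eps <.,.> - l q.  Integrating over x shows that some x
    compensates the rise as long as Phi <= n/6.  At l = 1 a finite potential
    says that q(f,f) <= eps |f|^2 for all f that vanish at the n points, so that
    any function of the unit ball with the observed values recovers f up to a
    squared error of 4 eps.  The initial potential sum_j lambda_j / (eps +
    lambda_j) is at most n/6 if eps is at least 12/n times the sum of the
    lambda_j with j >= n/12; this gives the bound even without the logarithm. *)

Require Import Defs.
From HB Require Import structures.
From mathcomp Require Import all_boot all_order all_algebra sesquilinear.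
From mathcomp Require Import all_classical all_reals all_analysis.
From mathcomp Require Import measurable_realfun.
From mathcomp Require Import complex ring lra.
Set Implicit Arguments.
Unset Strict Implicit.
Unset Printing Implicit Defensive.
Import Order.TTheory GRing.Theory Num.Theory.
Import numFieldNormedType.Exports.
Local Open Scope classical_set_scope.
Local Open Scope complex_scope.
Local Open Scope ring_scope.

(** * Hermitian forms *)

(** The obstacle is that Id need not be injective: q may have null vectors, and these vanish only
    almost everywhere. The eigenvectors of q do not see them, so a series in eigenvectors can
    represent evaluation at x in the form G only if evaluation at x kills every null vector.
    Separability of H(K) yields one null set of bad points that serves for all null vectors at once,
    and the average over x ignores it.

    Inverses and traces of operators never appear. The potential bounds the sum of q over every
    G-orthonormal family, so comparing S with its section f(x) = 0 takes a single such family and no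
    update formula for an inverse.

    The numerator lambda_j of the potential fits the average over x: the integral of |e_j(x)|^2 is
    q(e_j, e_j) = lambda_j. The start l = -1 keeps each initial term below 1, so that the large
    eigenvalues cost no more than their number. *)

Section complex_aux.
Context {R : realType}.
Implicit Types z w : R[i].

(** The squared modulus, with values in [R] rather than [R[i]], so that estimates stay within reach
    of [lra] and [nra]. *)
Definition sqn z : R := complex.Re z ^+ 2 + complex.Im z ^+ 2.

Lemma ReD z w : complex.Re (z + w) = complex.Re z + complex.Re w.
Proof. by case: z w => [? ?] []. Qed.

Lemma ReN z : complex.Re (- z) = - complex.Re z.
Proof. by case: z. Qed.

Lemma ImD z w : complex.Im (z + w) = complex.Im z + complex.Im w.
Proof. by case: z w => [? ?] []. Qed.

Lemma ImN z : complex.Im (- z) = - complex.Im z.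
Proof. by case: z. Qed.

Lemma Re_sum I (s : seq I) (F : I -> R[i]) :
  complex.Re (\sum_(i <- s) F i) = \sum_(i <- s) complex.Re (F i).
Proof. by elim/big_rec2: _ => // i y1 y2 _ <-; rewrite ReD. Qed.

Lemma Re_conj z : complex.Re (Num.conj z) = complex.Re z.
Proof. by case: z. Qed.

Lemma Re_rM (a : R) z : complex.Re (a%:C * z) = a * complex.Re z.
Proof. by case: z => x y /=; rewrite mul0r subr0. Qed.

(* Restatements of the morphism lemmas of [Num.conj] that leave no coercion
   behind. *)
Lemma conjM z w : Num.conj (z * w) = Num.conj z * Num.conj w.
Proof. exact: rmorphM. Qed.

Lemma conjD z w : Num.conj (z + w) = Num.conj z + Num.conj w.
Proof. exact: rmorphD. Qed.

Lemma conjN z : Num.conj (- z) = - Num.conj z.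
Proof. exact: rmorphN. Qed.

Lemma conj0 : Num.conj 0 = 0 :> R[i].
Proof. exact: rmorph0. Qed.

Lemma conj_real (a : R) : Num.conj a%:C = a%:C.
Proof. exact: conjc_real. Qed.

Lemma mul_conj_sqn z : z * Num.conj z = (sqn z)%:C.
Proof.
case: z => a b; apply/eqP; rewrite eq_complex /sqn /=; apply/andP; split;
apply/eqP; ring.
Qed.

Lemma sqn_ge0 z : 0 <= sqn z.
Proof. by rewrite addr_ge0 ?sqr_ge0. Qed.

Lemma sqn_eq0 z : sqn z = 0 -> z = 0.
Proof.
move/eqP; case: z => a b.
by rewrite /sqn paddr_eq0 ?sqr_ge0 //= !sqrf_eq0 => /andP[/eqP-> /eqP->].
Qed.

Lemma sqn0 : sqn 0 = 0 :> R.
Proof. by rewrite /sqn /= expr0n /= addr0. Qed.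

Lemma sqn_conj z : sqn (Num.conj z) = sqn z.
Proof. by case: z => a b; rewrite /sqn /= sqrrN. Qed.

Lemma sqnM z w : sqn (z * w) = sqn z * sqn w.
Proof. by case: z w => [a b] [c e]; rewrite /sqn /=; ring. Qed.

Lemma sqn_real (a : R) : sqn a%:C = a ^+ 2.
Proof. by rewrite /sqn /= expr0n addr0. Qed.

Lemma sqnD_le z w : sqn (z + w) <= 2 * sqn z + 2 * sqn w.
Proof.
case: z w => [a b] [c e]; rewrite /sqn /=.
by have := sqr_ge0 (a - c); have := sqr_ge0 (b - e); nra.
Qed.

Lemma normr_sqn z : complex.Re `|z| ^+ 2 = sqn z.
Proof. by rewrite normc_def /= sqr_sqrtr // sqn_ge0. Qed.

End complex_aux.

Section forms.
Context {R : realType} {V : lmodType R[i]}.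
Implicit Types (B : V -> V -> R[i]) (S : set V) (f g h : V) (s : seq V).

(** A predicate on bare functions: [barrier] and the L_2 form below are Hermitian only by virtue of
    hypotheses. *)
Definition herm B :=
  (forall a f g h, B (a *: f + g) h = a * B f h + B g h) /\
  (forall f g, B g f = Num.conj (B f g)).

Definition qf B f : R := complex.Re (B f f).

Definition subspace S := S 0 /\ forall a f g, S f -> S g -> S (a *: f + g).

(** Relative to [S], because the forms [M * dot - q] and [barrier] are nonnegative only on the
    subspace under study. *)
Definition psd_on S B := forall f, S f -> 0 <= qf B f.

Section subspace.
Variable S : set V.
Hypothesis hS : subspace S.

Lemma subspace0 : S 0. Proof. by case: hS. Qed.

Lemma subspaceZ a f : S f -> S (a *: f).
Proof. by move=> Sf; rewrite -[_ *: _]addr0; apply hS.2 => //; exact: hS.1. Qed.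

Lemma subspaceD f g : S f -> S g -> S (f + g).
Proof. by move=> Sf Sg; rewrite -[f]scale1r; exact: hS.2. Qed.

Lemma subspaceB f g : S f -> S g -> S (f - g).
Proof.
by move=> Sf Sg; apply: subspaceD => //; rewrite -scaleN1r; exact: subspaceZ.
Qed.

Lemma subspace_sum I (r : seq I) (F : I -> V) :
  (forall i, S (F i)) -> S (\sum_(i <- r) F i).
Proof.
move=> SF; elim/big_ind : _ => // [|x y]; first exact: subspace0.
exact: subspaceD.
Qed.

End subspace.

Section herm.
Variable B : V -> V -> R[i].
Hypothesis hB : herm B.

Lemma hermPl a f g h : B (a *: f + g) h = a * B f h + B g h.
Proof. exact: hB.1. Qed.

Lemma hermC f g : B g f = Num.conj (B f g).
Proof. exact: hB.2. Qed.

Lemma herm0l h : B 0 h = 0.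
Proof.
have := hermPl 1 0 0 h; rewrite scale1r addr0 mul1r => /eqP.
by rewrite -subr_eq0 opprD addNKr oppr_eq0 => /eqP.
Qed.

Lemma hermZl a f h : B (a *: f) h = a * B f h.
Proof. by rewrite -[_ *: _]addr0 hermPl herm0l addr0. Qed.

Lemma hermDl f g h : B (f + g) h = B f h + B g h.
Proof. by rewrite -[in LHS](scale1r f) hermPl mul1r. Qed.

Lemma hermNl f h : B (- f) h = - B f h.
Proof. by rewrite -scaleN1r hermZl mulN1r. Qed.

Lemma hermBl f g h : B (f - g) h = B f h - B g h.
Proof. by rewrite hermDl hermNl. Qed.

Lemma herm_suml I (r : seq I) (F : I -> V) h :
  B (\sum_(i <- r) F i) h = \sum_(i <- r) B (F i) h.
Proof. by elim/big_rec2: _ => [|i y1 y2 _ <-]; rewrite ?herm0l ?hermDl. Qed.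

Lemma herm0r h : B h 0 = 0.
Proof. by rewrite hermC herm0l conj0. Qed.

Lemma hermZr a f h : B h (a *: f) = Num.conj a * B h f.
Proof. by rewrite [LHS]hermC hermZl conjM (hermC f h). Qed.

Lemma hermDr f g h : B h (f + g) = B h f + B h g.
Proof. by rewrite [LHS]hermC hermDl conjD (hermC f h) (hermC g h). Qed.

Lemma hermNr f h : B h (- f) = - B h f.
Proof. by rewrite [LHS]hermC hermNl conjN (hermC f h). Qed.

Lemma hermBr f g h : B h (f - g) = B h f - B h g.
Proof. by rewrite hermDr hermNr. Qed.

Lemma herm_sumr I (r : seq I) (F : I -> V) h :
  B h (\sum_(i <- r) F i) = \sum_(i <- r) B h (F i).
Proof. by elim/big_rec2: _ => [|i y1 y2 _ <-]; rewrite ?herm0r ?hermDr. Qed.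

Lemma herm_eq0C f g : B f g = 0 -> B g f = 0.
Proof. by move=> e; rewrite hermC e conj0. Qed.

Lemma qfE f : B f f = (qf B f)%:C.
Proof.
have := hermC f f; rewrite /qf; case: (B f f) => a b /= [] /eqP.
by rewrite -subr_eq0 opprK -mulr2n mulrn_eq0 /= => /eqP ->.
Qed.

Lemma qf0 : qf B 0 = 0.
Proof. by rewrite /qf herm0l. Qed.

Lemma qfN f : qf B (- f) = qf B f.
Proof. by rewrite /qf hermNl hermNr opprK. Qed.

Lemma qfBC f g : qf B (f - g) = qf B (g - f).
Proof. by rewrite -qfN opprB. Qed.

Lemma qfZ a f : qf B (a *: f) = sqn a * qf B f.
Proof. by rewrite {1}/qf hermZl hermZr mulrA mul_conj_sqn Re_rM. Qed.

Lemma qfD f g : qf B (f + g) = qf B f + 2 * complex.Re (B f g) + qf B g.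
Proof.
rewrite /qf hermDl !hermDr !ReD [B g f]hermC Re_conj; ring.
Qed.

Lemma qf_Bproj f h (t : R) :
  qf B (f - (t%:C * B f h) *: h) =
  qf B f - 2 * t * sqn (B f h) + t ^+ 2 * sqn (B f h) * qf B h.
Proof.
rewrite qfD qfN qfZ hermNr ReN hermZr conjM conj_real -mulrA.
by rewrite [Num.conj _ * _]mulrC mul_conj_sqn sqnM sqn_real Re_rM /=; ring.
Qed.

Lemma qf_parallelogram f g :
  qf B (f + g) + qf B (f - g) = 2 * qf B f + 2 * qf B g.
Proof. rewrite !qfD qfN hermNr ReN; ring. Qed.

Section psd.
Variable S : set V.
Hypotheses (hS : subspace S) (posB : psd_on S B).

Lemma cauchy_schwarz f g : S f -> S g -> sqn (B f g) <= qf B f * qf B g.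
Proof.
move=> Sf Sg; set s := sqn _; have s0 : 0 <= s := sqn_ge0 _.
have key t : 0 <= qf B f - 2 * t * s + t ^+ 2 * s * qf B g.
  by rewrite -qf_Bproj; apply: posB; apply: subspaceB => //; apply: subspaceZ.
have f0 := posB Sf; have := posB Sg; rewrite le_eqVlt => /orP[/eqP g0|g0].
  have [->|sN0] := eqVneq s 0; first by rewrite -g0 mulr0.
  (* For a null vector [g] the bound is affine in the parameter; at this value it reads
     [0 <= -1]. *)
  have := key ((qf B f + 1) / (2 * s)); rewrite -g0 mulr0 addr0.
  have -> : 2 * ((qf B f + 1) / (2 * s)) * s = qf B f + 1 by field.
  lra.
have := key (qf B g)^-1.
have -> : (qf B g)^-1 ^+ 2 * s * qf B g = s / qf B g by field; lra.
have -> : 2 * (qf B g)^-1 * s = 2 * (s / qf B g) by ring.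
by rewrite -ler_pdivrMr //; lra.
Qed.

Lemma psd_null f g : S f -> S g -> qf B g = 0 -> B f g = 0.
Proof.
move=> Sf Sg g0; apply: sqn_eq0; apply/eqP; rewrite eq_le sqn_ge0 andbT.
by have := cauchy_schwarz Sf Sg; rewrite g0 mulr0.
Qed.

Lemma qfD_le2 f g : S f -> S g -> qf B (f + g) <= 2 * qf B f + 2 * qf B g.
Proof.
move=> Sf Sg; rewrite -qf_parallelogram lerDl; apply: posB.
exact: subspaceB.
Qed.

End psd.

(** Zero vectors are allowed, so that a list of eigenvectors qualifies even beyond the rank of the
    form. *)
Fixpoint orthon s : Prop := if s is f :: s' then
  [/\ B f f = 1 \/ f = 0, (forall g, g \in s' -> B f g = 0) & orthon s']
  else True.

Definition residual s f := f - \sum_(h <- s) B f h *: h.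

Lemma residual_cons h s f : (forall g, g \in s -> B h g = 0) ->
  residual (h :: s) f = residual s (f - B f h *: h).
Proof.
move=> hs; rewrite /residual big_cons opprD addrA; congr (_ - _).
apply: eq_big_seq => g gs.
by rewrite hermBl hermZl hs // mulr0 subr0.
Qed.

Lemma herm_subproj f h : B h h = 1 \/ h = 0 -> B (f - B f h *: h) h = 0.
Proof.
case=> [h1|->]; last by rewrite herm0r.
by rewrite hermBl hermZl h1 mulr1 subrr.
Qed.

Lemma qf_subproj f h : B h h = 1 \/ h = 0 ->
  qf B (f - B f h *: h) = qf B f - sqn (B f h).
Proof.
case=> [h1|->]; last by rewrite herm0r sqn0 scaler0 !subr0.
have q1 : qf B h = 1 by rewrite /qf h1.
by have := qf_Bproj f h 1; rewrite mul1r q1 => ->; ring.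
Qed.

Lemma residual_orth s f g : orthon s -> g \in s -> B (residual s f) g = 0.
Proof.
elim: s f => // h s ih f [hh hs os]; rewrite residual_cons // inE.
case/orP=> [/eqP ->|]; last exact: ih.
rewrite /residual hermBl herm_suml big1_seq ?subr0 ?herm_subproj // => k /= ks.
by rewrite hermZl (herm_eq0C (hs _ ks)) mulr0.
Qed.

Lemma qf_residual s f : orthon s ->
  qf B (residual s f) = qf B f - \sum_(h <- s) sqn (B f h).
Proof.
elim: s f => [|h s ih] f; first by rewrite /residual !big_nil !subr0.
move=> [hh hs os]; rewrite residual_cons // ih // qf_subproj //.
rewrite big_cons (opprD (sqn _)) addrA; congr (_ - _).
by apply: eq_big_seq => g gs; rewrite hermBl hermZl hs // mulr0 subr0.
Qed.

Lemma residual_subspace S s f : subspace S -> (forall h, h \in s -> S h) ->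
  S f -> S (residual s f).
Proof.
move=> hS hs Sf; apply: subspaceB => //; rewrite big_seq.
elim/big_ind : _ => [|x y|h hh]; [exact: subspace0|exact: subspaceD|].
by apply: subspaceZ => //; exact: hs.
Qed.

Lemma bessel S s f : subspace S -> psd_on S B -> orthon s ->
  (forall h, h \in s -> S h) -> S f -> \sum_(h <- s) sqn (B f h) <= qf B f.
Proof.
move=> hS pB os hs Sf; rewrite -subr_ge0 -qf_residual //.
by apply: pB; exact: residual_subspace.
Qed.

Lemma orthon_map_iota (e : nat -> V) m n :
  (forall j, B (e j) (e j) = 1 \/ e j = 0) ->
  (forall i j, i != j -> B (e i) (e j) = 0) ->
  orthon (map e (iota m n)).
Proof.
move=> e1 e0; elim: n m => //= n ih m; split => // g /mapP[j].
rewrite mem_iota => /andP[mj _] ->; apply: e0.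
by rewrite neq_ltn mj.
Qed.

End herm.

End forms.

(** * Spectral theorem for a trace-class form *)

(** Compactness of [[-b, b]]. Ultrafilters replace the extraction of subsequences: one ultrafilter
    makes all coordinates converge simultaneously. *)
Lemma ultra_bounded_cvg {R : realType} (U : set_system nat) (r : nat -> R) (b : R) :
  UltraFilter U -> (forall n, `|r n| <= b) ->
  exists l : R, forall eps : R, 0 < eps -> U [set n | `|r n - l| <= eps].
Proof.
move=> UU rb.
have PF : ProperFilter (r @ U) by exact: fmap_proper_filter.
have rI : U (r @^-1` [set` `[- b, b]]).
  apply: (@filterS _ U _ setT _ _ filterT) => n _ /=.
  by rewrite in_itv /= -ler_norml.
have [l [_ cl]] := @segment_compact R (- b) b _ PF rI.
exists l => eps eps0.
have [//|Un] := in_ultra_setVsetC [set n | `|r n - l| <= eps] UU.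
have : (r @ U) (~` [set y | `|y - l| <= eps]) by exact: Un.
move/cl => /(_ (ball l eps) (nbhsx_ballx _ _ eps0)) [y [/= yN]].
by rewrite /ball /= distrC => /ltW.
Qed.

Section abstract_hilbert.
Context {R : realType} {V : lmodType R[i]}.
Implicit Types (B q dot : V -> V -> R[i]) (S : set V) (f g h : V) (s : seq V)
  (eps lam M : R).

Definition qcomplete dot := forall u : nat -> V,
  (forall eps, 0 < eps -> exists N, forall m n, (N <= m)%N -> (N <= n)%N ->
     qf dot (u m - u n) <= eps) ->
  exists f, forall eps, 0 < eps -> exists N, forall n, (N <= n)%N ->
     qf dot (f - u n) <= eps.

Definition hilbert_form dot := [/\ herm dot, psd_on setT dot,
  (forall f, qf dot f = 0 -> f = 0) & qcomplete dot].

Definition qclosed dot S := forall f,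
  (forall eps, 0 < eps -> exists2 g, S g & qf dot (f - g) <= eps) -> S f.

Lemma subspaceT : subspace [set: V].
Proof. by []. Qed.

Lemma qf_amgm B S f g (t : R) : herm B -> subspace S -> psd_on S B ->
  S f -> S g -> 0 < t -> 2 * `|complex.Re (B f g)| <= t * qf B f + t^-1 * qf B g.
Proof.
move=> hB hS pB Sf Sg t0.
have key c : c ^+ 2 = 1 -> 2 * (c * complex.Re (B f g)) <= t * qf B f + t^-1 * qf B g.
  move=> c2.
  have := pB (t%:C *: f - c%:C *: g).
  rewrite qfD // qfN // !qfZ // hermNr // ReN hermZl // hermZr // !sqn_real.
  rewrite conj_real !Re_rM c2 mul1r => /(_ (subspaceB hS _ _)) key.
  have {}key := key (subspaceZ hS _ Sf) (subspaceZ hS _ Sg).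
  rewrite -(ler_pM2l t0).
  have -> : t * (t * qf B f + t^-1 * qf B g) = t ^+ 2 * qf B f + qf B g.
    by field; rewrite gt_eqF.
  nra.
have [r0|r0] := leP 0 (complex.Re (B f g)).
  by rewrite ger0_norm // -[X in 2 * X]mul1r; apply: key; rewrite expr1n.
by rewrite ltr0_norm // -[X in 2 * X]mulN1r; apply: key; rewrite sqrrN expr1n.
Qed.

Lemma qf_continuous dot B (C : R) : herm dot -> psd_on setT dot ->
  herm B -> psd_on setT B ->
  (forall f, qf B f <= C * qf dot f) ->
  forall f eps, 0 < eps -> exists2 delta, 0 < delta &
    forall g, qf dot (f - g) <= delta -> `|qf B f - qf B g| <= eps.
Proof.
move=> hd pd hB pB BC f eps eps0.
have f0 : 0 <= qf B f by exact: pB.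
(* This [t] makes the term [t * qf B f] of [qf_amgm] at most [eps / 2]; the radius below does the
   same for [(t^-1 + 1) * qf B h]. *)
pose t := eps / (2 * (qf B f + 1)).
have t0 : 0 < t by rewrite divr_gt0 ?mulr_gt0 // ltr_wpDl.
pose C' := `|C| + 1.
have C'0 : 0 < C' by rewrite ltr_wpDl.
have BC' g : qf B g <= C' * qf dot g.
  apply: le_trans (BC g) _; apply: ler_wpM2r; first exact: pd.
  by rewrite /C'; have := ler_norm C; lra.
have tV : 0 < t^-1 by rewrite invr_gt0.
exists (eps / (2 * (t^-1 + 1) * C')) => [|g fg].
  by rewrite divr_gt0 // !mulr_gt0 // addr_gt0.
have -> : g = f - (f - g) by rewrite opprB addrCA subrr addr0.
set h := f - g in fg *.
have h1 : (t^-1 + 1) * qf B h <= eps / 2.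
  have : (t^-1 + 1) * qf B h <= (t^-1 + 1) * (C' * (eps / (2 * (t^-1 + 1) * C'))).
    rewrite ler_pM2l ?addr_gt0 //; apply: le_trans (BC' h) _.
    by rewrite ler_pM2l.
  suff -> : (t^-1 + 1) * (C' * (eps / (2 * (t^-1 + 1) * C'))) = eps / 2 by [].
  by field; rewrite !gt_eqF // ltr_wpDl ?ltW.
have h2 : t * qf B f <= eps / 2.
  rewrite /t -mulrA [_^-1 * _]mulrC mulrA ler_pdivrMr ?mulr_gt0 ?ltr_wpDl //.
  nra.
have h0 : 0 <= qf B h by exact: pB.
have := qf_amgm hB subspaceT pB I I t0 (f := f) (g := h).
rewrite qfD // qfN // hermNr // ReN.
move=> h3; rewrite ler_norml; have := ler_norm (complex.Re (B f h)).
have := ler_norm (- complex.Re (B f h)); rewrite normrN => n1 n2.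
by apply/andP; split; lra.
Qed.

Lemma normalize B f : herm B -> psd_on setT B -> qf B f != 0 ->
  B ((Num.sqrt (qf B f))^-1%:C *: f) ((Num.sqrt (qf B f))^-1%:C *: f) = 1.
Proof.
move=> hB pB f0.
rewrite qfE // qfZ // sqn_real exprVn sqr_sqrtr; last exact: pB.
by rewrite mulVf.
Qed.

Section trace_form.
Variables (dot q : V -> V -> R[i]) (T : R).
Hypothesis hH : hilbert_form dot.
Hypotheses (hq : herm q) (pq : psd_on setT q).
(** Trace at most [T], tested on finite orthonormal families: for the embedding this is Bessel's
    inequality integrated over the points. *)
Hypothesis qT : forall s, orthon dot s -> \sum_(h <- s) qf q h <= T.

Let hd : herm dot. Proof. by case: hH. Qed.
Let pd : psd_on setT dot. Proof. by case: hH. Qed.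
Let dot0 f : qf dot f = 0 -> f = 0. Proof. by case: hH => _ _ + _; apply. Qed.

Lemma unit_scale f : f != 0 -> exists r : R, exists g,
  [/\ r ^+ 2 = qf dot f, dot g g = 1, f = r%:C *: g & g = (r^-1)%:C *: f].
Proof.
move=> f0; have q0 : qf dot f != 0 by apply: contra_neq f0 => /dot0.
have qp : 0 < qf dot f by rewrite lt_def q0; exact: pd.
exists (Num.sqrt (qf dot f)), ((Num.sqrt (qf dot f))^-1%:C *: f).
split => //; [by rewrite sqr_sqrtr ?ltW|exact: normalize|].
rewrite scalerA -[X in X *: f](rmorphM (real_complex R)) mulfV ?scale1r //.
by rewrite gt_eqF // sqrtr_gt0.
Qed.

Lemma qf_le_trace f : qf q f <= T * qf dot f.
Proof.
have [->|f0] := eqVneq f 0; first by rewrite !qf0 // mulr0.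
have [r [g [r2 g1 fE _]]] := unit_scale f0.
rewrite -r2 mulrC {1}fE qfZ // sqn_real; apply: ler_wpM2l; first exact: sqr_ge0.
have : orthon dot [:: g] by split => //; left.
by move/qT; rewrite big_seq1.
Qed.

Lemma trace_ge0 : 0 <= T.
Proof. by have := qT (s := [::]) I; rewrite big_nil. Qed.

(** Take [s] with a sum within [eps] of the supremum over orthonormal families in [S]: a further
    orthonormal vector can add at most [eps]. *)
Lemma small_tail S eps : subspace S -> 0 < eps -> exists s,
  [/\ orthon dot s, forall h, h \in s -> S h &
   forall f, S f -> (forall h, h \in s -> dot f h = 0) ->
     qf q f <= eps * qf dot f].
Proof.
move=> hS eps0.
pose A := [set t | exists s, [/\ orthon dot s, forall h, h \in s -> S h &
  t = \sum_(h <- s) qf q h]].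
have A0 : A 0 by exists [::]; rewrite big_nil.
have Au : ubound A T by move=> _ [s [os _ ->]]; exact: qT.
have hA : has_sup A by split; [exists 0|exists T].
have [_ [s [os Ss ->] lts]] := sup_adherent eps0 hA.
exists s; split => // f Sf fs.
have [->|f0] := eqVneq f 0; first by rewrite !qf0 // mulr0.
have [r [g [r2 g1 fE gE]]] := unit_scale f0.
rewrite -r2 mulrC {1}fE qfZ // sqn_real; apply: ler_wpM2l; first exact: sqr_ge0.
have : A (\sum_(h <- g :: s) qf q h).
  exists (g :: s); split => //.
    split => //; first by left.
    by move=> h hs; rewrite gE hermZl // fs // mulr0.
  move=> h; rewrite inE => /orP[/eqP ->|]; last exact: Ss.
  by rewrite gE; exact: subspaceZ.
by move/(sup_upper_bound hA); rewrite big_cons; lra.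
Qed.

Lemma qf_proj s f : orthon dot s ->
  qf dot (f - residual dot s f) = \sum_(h <- s) sqn (dot f h).
Proof.
move=> os; have := qf_residual hd f os.
have E : f - residual dot s f = \sum_(h <- s) dot f h *: h.
  by rewrite /residual opprB addrCA subrr addr0.
have PR : dot (residual dot s f) (f - residual dot s f) = 0.
  apply: herm_eq0C => //; rewrite E herm_suml // big1_seq // => h /= hs.
  by rewrite hermZl // (herm_eq0C hd (residual_orth hd f os hs)) mulr0.
have := qfD hd (residual dot s f) (f - residual dot s f).
rewrite PR addrCA subrr addr0 => ->.
by rewrite /= mulr0 addr0; lra.
Qed.

Lemma qf_approx_ge f (M : R) :
  (forall eps, 0 < eps -> exists2 g, qf dot (f - g) <= eps & M - eps <= qf q g) ->
  M <= qf q f.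
Proof.
move=> H; apply/ler_addgt0Pr => eps eps0.
have e2 : 0 < eps / 2 by rewrite divr_gt0.
have [delta d0 fd] := qf_continuous hd pd hq pq qf_le_trace f e2.
have m0 : 0 < Num.min delta (eps / 2) by rewrite lt_min d0.
have [g fg gM] := H _ m0.
have gd : qf dot (f - g) <= delta by apply: le_trans fg _; rewrite ge_min lexx.
have := fd g gd; rewrite ler_norml => /andP[f1 _].
have : Num.min delta (eps / 2) <= eps / 2 by rewrite ge_min lexx orbT.
lra.
Qed.

Lemma ultra_coord_cauchy (U : set_system nat) (u : nat -> V) s :
  UltraFilter U -> (forall n, qf dot (u n) <= 1) ->
  forall eps, 0 < eps -> exists2 A : set nat, U A &
    forall m n, A m -> A n -> \sum_(h <- s) sqn (dot (u m - u n) h) <= eps.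
Proof.
move=> UU u1; elim: s => [|h s ih] eps eps0.
  by exists setT => [|m n _ _]; [exact: filterT|rewrite big_nil ltW].
have e2 : 0 < eps / 2 by rewrite divr_gt0.
have [A UA As] := ih _ e2.
pose b := 1 + qf dot h.
have h0 : 0 <= qf dot h by exact: pd.
have b0 : 0 <= b by rewrite /b addr_ge0.
have ub n : sqn (dot (u n) h) <= b ^+ 2.
  apply: le_trans (cauchy_schwarz hd subspaceT pd I I) _.
  have := pd (f := u n) I; have := u1 n; rewrite /b; nra.
have [|x xU] := @ultra_bounded_cvg R U (fun n => complex.Re (dot (u n) h)) b UU.
  move=> n; rewrite -ler_sqr ?nnegrE // real_normK ?num_real //.
  by apply: le_trans (ub n); rewrite /sqn lerDl sqr_ge0.
have [|y yU] := @ultra_bounded_cvg R U (fun n => complex.Im (dot (u n) h)) b UU.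
  move=> n; rewrite -ler_sqr ?nnegrE // real_normK ?num_real //.
  by apply: le_trans (ub n); rewrite /sqn lerDr sqr_ge0.
(* Both parts of the coordinate differ by at most [2 * r]; as [r <= 1], their squares are at most
   [4 * r <= eps / 4] each. *)
pose r := Num.min 1 (eps / 16).
have r0 : 0 < r by rewrite lt_min ltr01 divr_gt0.
have r1 : r <= 1 by rewrite ge_min lexx.
have r16 : r <= eps / 16 by rewrite ge_min lexx orbT.
exists (A `&` ([set n | `|complex.Re (dot (u n) h) - x| <= r] `&`
               [set n | `|complex.Im (dot (u n) h) - y| <= r])).
  by do 2?[apply: filterI] => //; [exact: xU|exact: yU].
move=> m n [Am [xm ym]] [An [xn yn]]; rewrite big_cons.
have := As _ _ Am An.
suff : sqn (dot (u m - u n) h) <= eps / 2 by lra.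
rewrite hermBl // /sqn ReD ImD ReN ImN.
move: xm ym xn yn => /=; rewrite !ler_norml.
move=> /andP[? ?] /andP[? ?] /andP[? ?] /andP[? ?].
have sq (v : R) : - (2 * r) <= v -> v <= 2 * r -> v ^+ 2 <= 4 * r by nra.
have := sq (complex.Re (dot (u m) h) - complex.Re (dot (u n) h)).
have := sq (complex.Im (dot (u m) h) - complex.Im (dot (u n) h)).
lra.
Qed.

(** A diagonal choice: [v k] is at least [k] and lies in the first [k + 1] large sets, so [u \o v]
    is Cauchy. Arbitrarily late terms of [u] approximate the limit, so that it inherits what holds
    only asymptotically along [u]. *)
Lemma cauchy_of_ultra (U : set_system nat) (u : nat -> V) :
  UltraFilter U -> \oo `<=` U ->
  (forall eps, 0 < eps -> exists2 A : set nat, U A &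
    forall m n, A m -> A n -> qf dot (u m - u n) <= eps) ->
  exists f, forall eps, 0 < eps -> forall N, exists2 n, (N <= n)%N &
    qf dot (f - u n) <= eps.
Proof.
move=> UU ooU uU.
have /choice[A hA] : forall k : nat, exists A : set nat, U A /\
    forall m n, A m -> A n -> qf dot (u m - u n) <= k.+1%:R^-1.
  by move=> k; have [|A ? ?] := uU (k.+1%:R^-1) _; [rewrite invr_gt0|exists A].
have UI k : U (\big[setI/setT]_(i < k.+1) A i).
  elim/big_ind : _ => [|B C|i _]; [exact: filterT|exact: filterI|].
  by case: (hA i).
have /choice[v hv] : forall k : nat, exists n, (k <= n)%N /\
    forall i, (i <= k)%N -> A i n.
  move=> k; have Uk : U [set n | (k <= n)%N] by apply: ooU; exists k.
  have [n [kn /= An]] := filter_ex (filterI Uk (UI k)).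
  exists n; split => // i ik; move: An; rewrite -bigcap_mkord; apply.
  by rewrite /= ltnS.
have [_ _ _ cH] := hH.
have [eps eps0|f fu] := cH (u \o v).
  have [N _ hN] : \forall k \near \oo, k.+1%:R^-1 <= eps.
    have := near_infty_natSinv_lt (PosNum eps0); apply: filterS => k /=.
    exact: ltW.
  exists N => m n Nm Nn; apply: le_trans (hN N (leqnn N)).
  by apply: (hA N).2; [exact: (hv m).2|exact: (hv n).2].
exists f => eps eps0 N; have [M hM] := fu _ eps0.
exists (v (maxn M N)); last by apply: hM; rewrite leq_maxl.
by apply: leq_trans (hv _).1; rewrite leq_maxr.
Qed.

(* Near-maximisers of [q] on the unit ball of [S]: the parallelogram identity
   bounds [M |f - g|^2] by [q (f - g)] up to a small error, while [q] is at most
   [M / 4] off a finite-dimensional space, so an ultrafilter that makes finitely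
   many coordinates converge makes the near-maximisers converge. *)
Lemma max_eigen S : subspace S -> qclosed dot S -> exists lam e,
  [/\ S e, (0 < lam /\ dot e e = 1) \/ (lam = 0 /\ e = 0),
      forall f, S f -> q f e = lam%:C * dot f e &
      forall f, S f -> qf q f <= lam * qf dot f].
Proof.
move=> hS cS.
pose A := [set t | exists2 f, S f /\ qf dot f <= 1 & t = qf q f].
have A0 : A 0 by exists 0; rewrite ?qf0 //; split => //; exact: subspace0.
have Au : ubound A T.
  move=> _ [f [_ f1] ->]; apply: le_trans (qf_le_trace f) _.
  by rewrite -[leRHS]mulr1 ler_wpM2l // trace_ge0.
have hA : has_sup A by split; [exists 0|exists T].
pose M : R := sup A.
have M0 : 0 <= M by exact: sup_upper_bound.
have qM f : S f -> qf q f <= M * qf dot f.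
  move=> Sf; have [->|f0] := eqVneq f 0; first by rewrite !qf0 // mulr0.
  have [r [g [r2 g1 fE gE]]] := unit_scale f0.
  rewrite -r2 mulrC {1}fE qfZ // sqn_real; apply: ler_wpM2l; first exact: sqr_ge0.
  apply: sup_upper_bound => //; exists g => //; split.
    by rewrite gE; exact: subspaceZ.
  by rewrite /qf g1.
have [M00|Mn0] := eqVneq M 0.
  exists 0, 0; split => //; [exact: subspace0|by right| |by rewrite -M00].
  by move=> f Sf; rewrite (herm0r hq) (herm0r hd) mulr0.
have {}M0 : 0 < M by rewrite lt_def Mn0.
have M4 : 0 < M / 4 by rewrite divr_gt0.
have [s [os Ss sM]] := small_tail hS M4.
have /choice[u hu] : forall n : nat, exists f,
    [/\ S f, qf dot f <= 1 & M - n.+1%:R^-1 <= qf q f].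
  move=> n; have n0 : 0 < n.+1%:R^-1 :> R by rewrite invr_gt0.
  have [_ [f [Sf f1] ->] fM] := sup_adherent n0 hA.
  by exists f; split => //; exact: ltW.
have [U [UU ooU]] := ultraFilterLemma (@eventually_filter : ProperFilter \oo).
have T0 := trace_ge0.
have [|f fu] := @cauchy_of_ultra U u UU ooU.
  move=> eps eps0.
  (* With [h = u m - u n], the aim is [M |h|^2 - eps M / 4 <= q(h, h) <= M |h|^2 / 2 + eps M / 4],
     hence [|h|^2 <= eps]. The two error terms dictate this constant and [eps * M / 16]. *)
  have e1 : 0 < eps * M / (8 * (T + 1)) by rewrite divr_gt0 ?mulr_gt0 // ltr_wpDl.
  have u1 n : qf dot (u n) <= 1 by case: (hu n).
  have [B UB hB] := ultra_coord_cauchy s UU u1 e1.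
  have e2 : 0 < eps * M / 16 by rewrite divr_gt0 ?mulr_gt0.
  have [N _ hN] : \forall k \near \oo, k.+1%:R^-1 <= eps * M / 16.
    have := near_infty_natSinv_lt (PosNum e2); apply: filterS => k /=.
    exact: ltW.
  exists (B `&` [set n | (N <= n)%N]).
    by apply: filterI => //; apply: ooU; exists N.
  move=> m n [Bm /= /hN Nm] [Bn /= /hN Nn].
  have [Sm m1 mM] := hu m; have [Sn n1 nM] := hu n.
  have Smn := subspaceB hS Sm Sn.
  set h := u m - u n in Smn *.
  have p1 := qf_parallelogram hq (u m) (u n).
  have p2 := qf_parallelogram hd (u m) (u n).
  have p3 := qM _ (subspaceD hS Sm Sn).
  have Sr := residual_subspace dot hS Ss Smn.
  have p4 := sM _ Sr (fun g gs => residual_orth hd h os gs).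
  have p5 : qf dot (residual dot s h) <= qf dot h.
    rewrite qf_residual // gerBl sumr_ge0 // => i _; exact: sqn_ge0.
  have p6 := qf_le_trace (h - residual dot s h).
  rewrite qf_proj // in p6.
  have p7 := hB _ _ Bm Bn.
  have p8 := qfD_le2 hq subspaceT pq
    (f := residual dot s h) (g := h - residual dot s h) I I.
  rewrite addrCA subrr addr0 in p8.
  rewrite -/h in p1 p2 p7.
  have p9 : T * \sum_(h0 <- s) sqn (dot h h0) <= eps * M / 8.
    have -> : eps * M / 8 = (T + 1) * (eps * M / (8 * (T + 1))).
      by field; rewrite gt_eqF // ltr_wpDl.
    apply: ler_pM => //; [|lra].
    by apply: sumr_ge0 => i _; exact: sqn_ge0.
  rewrite -(ler_pM2l M0).
  have p10 : M * qf dot (u m + u n) =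
      M * (2 * qf dot (u m) + 2 * qf dot (u n)) - M * qf dot h.
    by rewrite -p2; ring.
  have p11 : M * (2 * qf dot (u m) + 2 * qf dot (u n)) <= 4 * M by nra.
  have p12 : M / 4 * qf dot (residual dot s h) <= M / 4 * qf dot h by rewrite ler_pM2l.
  rewrite [M * eps]mulrC.
  have p13 : M / 4 * qf dot h = M * qf dot h / 4 by ring.
  have a0 : qf q (h - residual dot s h) <= eps * M / 8 by exact: le_trans p6 p9.
  have a1 : qf q h <= M * qf dot h / 2 + eps * M / 4 by lra.
  have a2 : M * qf dot h - eps * M / 4 <= qf q h.
    have a3 : qf q (u m + u n) <= 4 * M - M * qf dot h by lra.
    have m2 : M - eps * M / 16 <= qf q (u m).
      by apply: le_trans mM; rewrite lerD2l lerN2.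
    have n2 : M - eps * M / 16 <= qf q (u n).
      by apply: le_trans nM; rewrite lerD2l lerN2.
    lra.
  lra.
have Sf : S f.
  apply: cS => eps eps0; have [n _ ?] := fu _ eps0 0%N.
  by exists (u n) => //; have [] := hu n.
have qfM : M <= qf q f.
  apply: qf_approx_ge => eps eps0.
  have [N _ hN] : \forall k \near \oo, k.+1%:R^-1 <= eps.
    have := near_infty_natSinv_lt (PosNum eps0); apply: filterS => k /=.
    exact: ltW.
  have [n Nn fn] := fu _ eps0 N.
  exists (u n) => //; have [_ _] := hu n; apply: le_trans.
  by rewrite lerD2l lerN2; exact: hN.
have f1 : qf dot f = 1.
  apply/eqP; rewrite eq_le; apply/andP; split; last first.
    by rewrite -(ler_pM2l M0) mulr1; apply: le_trans qfM (qM _ Sf).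
  apply/ler_addgt0Pr => eps eps0.
  have hdd : forall g, qf dot g <= 1 * qf dot g by move=> g; rewrite mul1r.
  have [delta d0 fd] := qf_continuous hd pd hd pd hdd f eps0.
  have [n _ fn] := fu _ d0 0%N.
  have := fd _ fn; rewrite ler_norml => /andP[_].
  have [_ n1 _] := hu n; lra.
have fM : qf q f = M.
  by apply/eqP; rewrite eq_le qfM andbT; have := qM _ Sf; rewrite f1 mulr1.
exists M, f; split => //; first by left; split => //; rewrite qfE // f1.
move=> g Sg.
(* The form [M * dot - q] is nonnegative on [S] and vanishes at [f]; by Cauchy-Schwarz [f] lies in
   its radical, which is the eigenvalue equation. *)
pose p := fun x y => M%:C * dot x y - q x y.
have hp : herm p.
  split => [a x y z|x y].
    rewrite /p !hermPl //; ring.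
  by rewrite /p conjD conjN conjM conj_real -(hermC hd) -(hermC hq).
have qfp x : qf p x = M * qf dot x - qf q x by rewrite {1}/qf /p ReD ReN Re_rM.
have pp : psd_on S p by move=> x Sx; rewrite qfp subr_ge0; exact: qM.
have := psd_null hp hS pp Sg Sf; rewrite qfp f1 fM mulr1 subrr => /(_ erefl).
by move/eqP; rewrite subr_eq0 => /eqP.
Qed.

End trace_form.

End abstract_hilbert.

(** * Eigenvectors by successive maximisation *)

Lemma nondecreasing_bounded_cauchy {R : realType} (s : nat -> R) (b : R) :
  (forall m n, (m <= n)%N -> s m <= s n) -> (forall n, s n <= b) ->
  forall eps : R, 0 < eps -> exists N, forall m n, (N <= m)%N -> (m <= n)%N ->
    s n - s m <= eps.
Proof.
move=> mono sb eps eps0.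
have hs : has_sup (range s).
  by split; [exists (s 0%N); exists 0%N|exists b => _ [n _ <-]; exact: sb].
have [_ [N _ <-] hN] := sup_adherent eps0 hs.
exists N => m n Nm mn.
have : s n <= sup (range s) by apply: sup_upper_bound => //; exists n.
have := mono _ _ Nm; lra.
Qed.

Section spectral.
Context {R : realType} {V : lmodType R[i]}.
Implicit Types (S : set V) (f g h : V) (s : seq V) (eps : R).
Variables (dot q : V -> V -> R[i]) (T : R).

Definition qlim (u : nat -> V) g := forall eps, 0 < eps ->
  exists N, forall n, (N <= n)%N -> qf dot (g - u n) <= eps.

Definition bounded_functional (F : V -> R[i]) :=
  (forall a f g, F (a *: f + g) = a * F f + F g) /\
  exists C : R, forall f, sqn (F f) <= C * qf dot f.

(* Beyond the rank of [q] on [S], the eigenvectors are [0]. *)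
Record spectral S (e : nat -> V) (lam : nat -> R) : Prop := Spectral {
  sp_mem : forall j, S (e j);
  sp_unit : forall j, (0 < lam j /\ dot (e j) (e j) = 1) \/
                      (lam j = 0 /\ e j = 0);
  sp_orth : forall i j, i != j -> dot (e i) (e j) = 0;
  sp_eig : forall j f, S f -> q f (e j) = (lam j)%:C * dot f (e j);
  sp_max : forall n f, S f -> (forall j, (j < n)%N -> dot f (e j) = 0) ->
    qf q f <= lam n * qf dot f;
  sp_sum : forall n, \sum_(0 <= j < n) lam j <= T
}.

Hypothesis hH : hilbert_form dot.
Hypotheses (hq : herm q) (pq : psd_on setT q).
Hypothesis qT : forall s, orthon dot s -> \sum_(h <- s) qf q h <= T.

Let hd : herm dot. Proof. by case: hH. Qed.
Let pd : psd_on setT dot. Proof. by case: hH. Qed.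

Lemma functional_lim F u g c (N : nat) : bounded_functional F -> qlim u g ->
  (forall n, (N <= n)%N -> F (u n) = c) -> F g = c.
Proof.
move=> [Flin [C FC]] ug Fu.
have FB f h : F (f - h) = F f - F h.
  by rewrite addrC -scaleN1r Flin mulN1r addrC.
apply/eqP; rewrite -subr_eq0; apply/eqP/sqn_eq0/eqP.
rewrite eq_le sqn_ge0 andbT; apply/ler_addgt0Pr => eps eps0; rewrite add0r.
have C0 : 0 < `|C| + 1 by rewrite ltr_wpDl.
have [M hM] := ug (eps / (`|C| + 1)) (divr_gt0 eps0 C0).
rewrite -(Fu (maxn N M)) ?leq_maxl // -FB; apply: le_trans (FC _) _.
have := hM _ (leq_maxr N M); rewrite ler_pdivlMr //; apply: le_trans.
rewrite mulrC; apply: ler_wpM2l; first exact: pd.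
by have := ler_norm C; lra.
Qed.

Lemma dot_bounded h : bounded_functional (dot^~ h).
Proof.
split => [a f g|]; first by rewrite hermPl.
exists (qf dot h) => f; rewrite mulrC.
exact: (cauchy_schwarz hd (@subspaceT _ V) pd).
Qed.

Lemma qclosed_ker F : bounded_functional F -> qclosed dot [set f | F f = 0].
Proof.
move=> [Flin [C FC]] f fF /=; apply/sqn_eq0/eqP; rewrite eq_le sqn_ge0 andbT.
apply/ler_addgt0Pr => eps eps0; rewrite add0r.
have C0 : 0 < `|C| + 1 by rewrite ltr_wpDl.
have [g /= g0 fg] := fF (eps / (`|C| + 1)) (divr_gt0 eps0 C0).
have -> : F f = F (f - g).
  by rewrite addrC -scaleN1r Flin g0 mulr0 add0r.
apply: le_trans (FC _) _; move: fg; rewrite ler_pdivlMr //; apply: le_trans.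
rewrite mulrC; apply: ler_wpM2l; first exact: pd.
by have := ler_norm C; lra.
Qed.

Lemma spectral_exists S : subspace S -> qclosed dot S ->
  exists e lam, spectral S e lam.
Proof.
move=> hS cS.
(* [pick] is total, with a junk value off the closed subspaces, so that [Sn] is a plain recursion on
   sets. *)
have /choice[pick hpick] : forall S' : set V, exists p : R * V,
    subspace S' -> qclosed dot S' ->
    [/\ S' p.2, (0 < p.1 /\ dot p.2 p.2 = 1) \/ (p.1 = 0 /\ p.2 = 0),
      forall f, S' f -> q f p.2 = p.1%:C * dot f p.2 &
      forall f, S' f -> qf q f <= p.1 * qf dot f].
  move=> S'; have [hS'|] := pselect (subspace S'); last by exists (0, 0).
  have [cS'|] := pselect (qclosed dot S'); last by exists (0, 0).
  by have [lam [e ?]] := max_eigen hH hq pq qT hS' cS'; exists (lam, e).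
pose fix Sn n := if n is n'.+1 then
  Sn n' `&` [set f | dot f (pick (Sn n')).2 = 0] else S.
have hSn n : subspace (Sn n) /\ qclosed dot (Sn n).
  elim: n => //= n [h1 h2]; split.
    split; first by split; [exact: subspace0|rewrite /= herm0l].
    move=> a f g [Sf f0] [Sg g0]; split; first exact: h1.2.
    by rewrite /= hermPl // f0 g0 mulr0 addr0.
  move=> f fS; split.
    by apply: h2 => eps /fS[g [Sg _] ?]; exists g.
  apply: (qclosed_ker (dot_bounded _)) => eps /fS[g [_ g0] fg].
  by exists g.
pose e j := (pick (Sn j)).2; pose lam j := (pick (Sn j)).1.
have Sn_sub i j : (i <= j)%N -> Sn j `<=` Sn i.
  by move/subnK <-; elim: (j - i)%N => // k ih f [/ih].
have p1 j : Sn j (e j) by have [] := hpick _ (hSn j).1 (hSn j).2.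
have p2 j : (0 < lam j /\ dot (e j) (e j) = 1) \/ (lam j = 0 /\ e j = 0).
  by have [] := hpick _ (hSn j).1 (hSn j).2.
have p3 j f : Sn j f -> q f (e j) = (lam j)%:C * dot f (e j).
  by have [_ _ + _] := hpick _ (hSn j).1 (hSn j).2; apply.
have p4 j f : Sn j f -> qf q f <= lam j * qf dot f.
  by have [_ _ _ +] := hpick _ (hSn j).1 (hSn j).2; apply.
have lt0 i j : (i < j)%N -> dot (e j) (e i) = 0.
  by move=> ij; have [] := Sn_sub _ _ ij _ (p1 j).
have orth i j : i != j -> dot (e i) (e j) = 0.
  by rewrite neq_ltn => /orP[/lt0|/lt0 //]; exact: herm_eq0C.
have Se j : S (e j) by exact: (Sn_sub 0%N j (leq0n j) _ (p1 j)).
have one j : dot (e j) (e j) = 1 \/ e j = 0 by case: (p2 j) => -[]; [left|right].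
have inSn n f : S f -> (forall j, (j < n)%N -> dot f (e j) = 0) -> Sn n f.
  move=> Sf; elim: n => //= n ih f0; split; last exact: f0.
  by apply: ih => j jn; apply: f0; exact: ltnW.
exists e, lam; split => //.
- move=> j f Sf.
  (* The maximisation gives the equation on [Sn j] only. The rest of [f] is a combination of earlier
     eigenvectors [e i], where both sides vanish: [e j] lies in [Sn i] and is orthogonal to
     [e i]. *)
  pose s := map e (iota 0 j).
  have os : orthon dot s by exact: orthon_map_iota.
  have Ss h : h \in s -> S h by case/mapP => i _ ->.
  have fE : f = residual dot s f + \sum_(h <- s) dot f h *: h by rewrite subrK.
  have /p3 : Sn j (residual dot s f).
    apply: inSn; first exact: residual_subspace.
    move=> i ij; apply: residual_orth => //; apply/mapP; exists i => //.
    by rewrite mem_iota.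
  set p := \sum_(h <- s) dot f h *: h in fE.
  have -> : q f (e j) = q (residual dot s f) (e j) + q p (e j).
    by rewrite -hermDl // -fE.
  have -> : dot f (e j) = dot (residual dot s f) (e j) + dot p (e j).
    by rewrite -hermDl // -fE.
  move=> ->; rewrite mulrDr; congr (_ + _); rewrite /p.
  rewrite !herm_suml // mulr_sumr; apply: eq_big_seq => _ /mapP[i + ->].
  rewrite mem_iota add0n => /andP[_ ij]; rewrite !hermZl //.
  rewrite (orth i j) ?ltn_eqF // !mulr0.
  have /p3 : Sn i (e j) by exact: (Sn_sub i j (ltnW ij) _ (p1 j)).
  by rewrite lt0 // mulr0 => /(herm_eq0C hq) ->; rewrite mulr0.
- by move=> n f Sf f0; apply: p4; exact: inSn.
- move=> n; have := qT (orthon_map_iota 0 n one orth).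
  rewrite big_map /index_iota subn0; apply: le_trans.
  apply: ler_sum => j _.
  rewrite {1}/qf p3 // qfE // -(rmorphM (real_complex R)) /=.
  case: (p2 j) => [[l0 e1]|[-> _]]; last by rewrite mul0r.
  by rewrite /qf e1 /= mulr1.
Qed.

(** * Expansions along the eigenvectors *)

Section consequences.
Variables (S : set V) (e : nat -> V) (lam : nat -> R).
Hypotheses (hS : subspace S) (cS : qclosed dot S) (sp : spectral S e lam).

Lemma sp_ge0 j : 0 <= lam j.
Proof. by case: (sp_unit sp j) => [[/ltW]|[->]]. Qed.

Lemma sp_one j : dot (e j) (e j) = 1 \/ e j = 0.
Proof. by case: (sp_unit sp j) => -[]; [left|right]. Qed.

Lemma sp_qf_le1 j : 0 <= qf dot (e j) <= 1.
Proof.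
rewrite /qf; case: (sp_one j) => ->; first by rewrite /= ler01 lexx.
by rewrite herm0l //= lexx ler01.
Qed.

Lemma sp_lamM j : lam j * qf dot (e j) = lam j.
Proof.
case: (sp_unit sp j) => [[_ e1]|[-> _]]; last by rewrite mul0r.
by rewrite /qf e1 mulr1.
Qed.

Lemma sp_qf j : qf q (e j) = lam j.
Proof. by rewrite /qf (sp_eig sp) ?Re_rM ?sp_lamM //; exact: (sp_mem sp). Qed.

Lemma sp_noninc i j : (i <= j)%N -> lam j <= lam i.
Proof.
move=> /subnK <-; elim: (j - i)%N => // k; apply: le_trans; rewrite addSn.
set n := (k + i)%N; rewrite -[leLHS]sp_qf.
have := sp_max sp (n := n) (sp_mem sp n.+1).
move=> /(_ _)/le_trans; apply => [l ln|].
  by apply: (sp_orth sp); rewrite gtn_eqF // ltnW.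
by have /andP[_ ?] := sp_qf_le1 n.+1; rewrite ler_piMr ?sp_ge0.
Qed.

(** By monotonicity [n * lam n] is at most the sum of the first [n] eigenvalues, hence at most
    [T]. *)
Lemma sp_lim0 eps : 0 < eps -> exists N, forall n, (N <= n)%N -> lam n <= eps.
Proof.
move=> eps0; have T0 := trace_ge0 qT.
exists (Num.truncn (T / eps)).+1 => n hn.
have : T / eps < n%:R.
  by apply: lt_le_trans (truncnS_gt _) _; rewrite ler_nat.
rewrite ltr_pdivrMr // mulrC => Tn.
have n0 : 0 < n%:R :> R by rewrite ltr0n; case: (n) hn.
rewrite -(ler_pM2r n0); apply: le_trans (ltW Tn); apply: le_trans (sp_sum sp n).
rewrite -[X in _ * X%:R]subn0 mulr_natr -sumr_const_nat big_nat [leRHS]big_nat.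
by apply: ler_sum => i /andP[_ /ltnW]; exact: sp_noninc.
Qed.

Lemma sp_null f : S f -> (forall j, dot f (e j) = 0) -> qf q f = 0.
Proof.
move=> Sf f0; apply/eqP; rewrite eq_le pq // andbT.
apply/ler_addgt0Pr => eps eps0; rewrite add0r.
have f1 : 0 < qf dot f + 1 by rewrite ltr_wpDl //; exact: pd.
have [N hN] := sp_lim0 (divr_gt0 eps0 f1).
apply: le_trans (sp_max sp (n := N) Sf (fun j _ => f0 j)) _.
have := hN N (leqnn _); rewrite ler_pdivlMr //; apply: le_trans.
by apply: ler_wpM2l; [exact: sp_ge0|rewrite lerDl].
Qed.

Definition pr n f := \sum_(0 <= j < n) dot f (e j) *: e j.

Lemma pr_residual n f : f - pr n f = residual dot (map e (iota 0 n)) f.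
Proof. by rewrite /residual big_map /pr /index_iota subn0. Qed.

Lemma orthon_e m n : orthon dot (map e (iota m n)).
Proof. by apply: orthon_map_iota => //; [exact: sp_one|exact: (sp_orth sp)]. Qed.

Lemma sp_bessel n f : \sum_(0 <= j < n) sqn (dot f (e j)) <= qf dot f.
Proof.
have := bessel hd (@subspaceT _ V) pd (orthon_e 0 n) (fun _ _ => I) (I : [set: V] f).
by rewrite big_map /index_iota subn0.
Qed.

Lemma dot_pr n j f : (j < n)%N -> dot (f - pr n f) (e j) = 0.
Proof.
move=> jn; rewrite pr_residual; apply: residual_orth => //; first exact: orthon_e.
by apply/mapP; exists j => //; rewrite mem_iota.
Qed.

Lemma pr_sub n f : S (pr n f).
Proof.
by apply: subspace_sum => // j; apply: subspaceZ => //; apply: (sp_mem sp).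
Qed.

Lemma qf_pr n f : S f ->
  qf q (f - pr n f) = qf q f - \sum_(0 <= j < n) lam j * sqn (dot f (e j)).
Proof.
move=> Sf; elim: n => [|n ih]; first by rewrite /pr !big_geq // !subr0.
rewrite big_nat_recr //= opprD addrA -ih {1}/pr big_nat_recr //= opprD addrA.
rewrite -/(pr n f); set x := f - pr n f.
have Sx : S x by apply: subspaceB => //; exact: pr_sub.
have xe : dot x (e n) = dot f (e n).
  rewrite hermBl // /pr herm_suml // big_nat big1 ?subr0 // => j /andP[_ jn].
  by rewrite hermZl // (sp_orth sp) ?mulr0 // ltn_eqF.
rewrite qfD // qfN // qfZ // hermNr // ReN hermZr // (sp_eig sp) // xe sp_qf.
by rewrite mulrCA [Num.conj _ * _]mulrC mul_conj_sqn Re_rM /=; ring.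
Qed.

(** A finite sum with an error bound in place of an infinite series; the error is later summed over
    finitely many vectors and sent to 0 with [lam n]. *)
Lemma parseval n f : S f ->
  0 <= qf q f - \sum_(0 <= j < n) lam j * sqn (dot f (e j)) <= lam n * qf dot f.
Proof.
move=> Sf; rewrite -qf_pr //; apply/andP; split; first exact: pq.
have Sx : S (f - pr n f) by apply: subspaceB => //; exact: pr_sub.
apply: le_trans (sp_max sp Sx _) _; first by move=> j; exact: dot_pr.
apply: ler_wpM2l; first exact: sp_ge0.
rewrite pr_residual qf_residual //; last exact: orthon_e.
by rewrite gerBl sumr_ge0 // => i _; exact: sqn_ge0.
Qed.

Lemma qf_combination (a : nat -> R[i]) m n :
  qf dot (\sum_(m <= j < n) a j *: e j) =
  \sum_(m <= j < n) sqn (a j) * qf dot (e j).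
Proof.
have [nm|mn] := leqP n m; first by rewrite !big_geq // qf0.
move: mn => /ltnW/subnK <-; elim: (n - m)%N => [|k ih].
  by rewrite !big_geq // qf0.
rewrite addSn !big_nat_recr ?leq_addl //= qfD // ih qfZ //.
suff -> : dot (\sum_(m <= i < k + m) a i *: e i)
    (a (k + m)%N *: e (k + m)%N) = 0 by rewrite /= mulr0 addr0.
rewrite herm_suml // big_nat big1 // => j /andP[_ jk].
by rewrite hermZl // hermZr // (sp_orth sp) ?ltn_eqF // !mulr0.
Qed.

Lemma riesz_fischer (a : nat -> R[i]) (C : R) :
  (forall n, \sum_(0 <= j < n) sqn (a j) * qf dot (e j) <= C) ->
  exists2 g, S g & qlim (fun n => \sum_(0 <= j < n) a j *: e j) g.
Proof.
move=> aC; pose s n := \sum_(0 <= j < n) sqn (a j) * qf dot (e j).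
have s0 j : 0 <= sqn (a j) * qf dot (e j).
  by rewrite mulr_ge0 ?sqn_ge0 //; exact: pd.
have sB m n : (m <= n)%N ->
    s n - s m = \sum_(m <= j < n) sqn (a j) * qf dot (e j).
  by move=> mn; rewrite /s (big_cat_nat _ mn) //= addrAC subrr add0r.
have smono m n : (m <= n)%N -> s m <= s n.
  by move=> mn; rewrite -subr_ge0 sB // sumr_ge0.
have [_ _ _ cH] := hH.
have key m n : (m <= n)%N -> qf dot (\sum_(0 <= j < n) a j *: e j -
    \sum_(0 <= j < m) a j *: e j) = s n - s m.
  move=> mn; rewrite sB // -qf_combination (big_cat_nat _ mn) //=.
  by rewrite addrAC subrr add0r.
have [|g hg] := cH (fun n => \sum_(0 <= j < n) a j *: e j).
  move=> eps eps0; have [N hN] := nondecreasing_bounded_cauchy smono aC eps0.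
  exists N => m n Nm Nn; have [mn|/ltnW nm] := leqP m n.
    by rewrite qfBC // key //; exact: hN.
  by rewrite key //; exact: hN.
exists g => //; apply: cS => eps eps0; have [N hN] := hg _ eps0.
exists (\sum_(0 <= j < N) a j *: e j); last exact: hN.
by apply: subspace_sum => // j; apply: subspaceZ => //; apply: (sp_mem sp).
Qed.

Lemma dot_combination (a : nat -> R[i]) n j : (j < n)%N ->
  dot (\sum_(0 <= i < n) a i *: e i) (e j) = a j * dot (e j) (e j).
Proof.
move=> jn; rewrite herm_suml // (bigD1_seq j) ?mem_index_iota ?iota_uniq //=.
rewrite big1 ?addr0 ?hermZl // => i ij; rewrite hermZl //.
by rewrite (sp_orth sp) ?mulr0.
Qed.

Lemma dot_qlim (a : nat -> R[i]) g j :
  qlim (fun n => \sum_(0 <= j < n) a j *: e j) g ->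
  dot g (e j) = a j * dot (e j) (e j).
Proof.
move=> ag; apply: (functional_lim (N := j.+1) (dot_bounded (e j)) ag) => n jn.
exact: dot_combination.
Qed.

(** Removing from [f] its expansion leaves a vector orthogonal to every [e j], which is null for [q]
    by [sp_null]. Identities between bounded functionals thus need checking only on eigenvectors and
    null vectors. *)
Lemma density F : bounded_functional F -> (forall j, F (e j) = 0) ->
  (forall f, S f -> qf q f = 0 -> F f = 0) -> forall f, S f -> F f = 0.
Proof.
move=> bF Fe Fq f Sf.
have [|g Sg fg] := riesz_fischer (a := fun j => dot f (e j)) (C := qf dot f).
  move=> n; apply: le_trans (sp_bessel n f); apply: ler_sum => j _.
  by rewrite ler_piMr ?sqn_ge0 //; case/andP: (sp_qf_le1 j).
have Flin := bF.1.
have F0 : F 0 = 0.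
  have := Flin 1 0 0; rewrite scale1r addr0 mul1r => /eqP.
  by rewrite -subr_eq0 opprD addNKr oppr_eq0 => /eqP.
have Fg : F g = 0.
  apply: (functional_lim (N := 0) bF fg) => n _.
  elim: n => [|n ih]; first by rewrite big_geq.
  by rewrite big_nat_recr //= addrC Flin Fe mulr0 add0r.
have -> : f = (1 : R[i]) *: (f - g) + g by rewrite scale1r subrK.
rewrite Flin Fg addr0 Fq ?mulr0 //; first exact: subspaceB.
apply: sp_null => [|j]; first exact: subspaceB.
rewrite hermBl // (dot_qlim j fg).
by case: (sp_one j) => ->; [rewrite mulr1 subrr|rewrite !(herm0r hd) mul0r subrr].
Qed.

End consequences.

End spectral.

(** * The barrier potential *)

Section potential.
Context {R : realType} {V : lmodType R[i]}.
Implicit Types (S : set V) (f g h k : V) (s : seq V).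
Variables (dot q : V -> V -> R[i]) (T : R).
Hypothesis hH : hilbert_form dot.
Hypotheses (hq : herm q) (pq : psd_on setT q).
Hypothesis qT : forall s, orthon dot s -> \sum_(h <- s) qf q h <= T.

Let hd : herm dot. Proof. by case: hH. Qed.
Let pd : psd_on setT dot. Proof. by case: hH. Qed.

Variables eps l : R.
Hypothesis eps0 : 0 < eps.

Definition barrier f g := eps%:C * dot f g - l%:C * q f g.

Lemma herm_barrier : herm barrier.
Proof.
split => [a x y z|x y]; first by rewrite /barrier !hermPl //; ring.
by rewrite /barrier conjD conjN !conjM !conj_real -(hermC hd) -(hermC hq).
Qed.

Lemma qf_barrier f : qf barrier f = eps * qf dot f - l * qf q f.
Proof. by rewrite {1}/qf /barrier ReD ReN !Re_rM. Qed.

Lemma bounded_functionalD (F1 F2 : V -> R[i]) (a b : R[i]) :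
  bounded_functional dot F1 -> bounded_functional dot F2 ->
  bounded_functional dot (fun f => a * F1 f + b * F2 f).
Proof.
move=> [l1 [C1 h1]] [l2 [C2 h2]]; split => [c f g|].
  by rewrite l1 l2; ring.
exists (2 * sqn a * C1 + 2 * sqn b * C2) => f.
apply: le_trans (sqnD_le _ _) _; rewrite !sqnM.
have := ler_wpM2l (sqn_ge0 a) (h1 f); have := ler_wpM2l (sqn_ge0 b) (h2 f); lra.
Qed.

Lemma q_bounded g : bounded_functional dot (q^~ g).
Proof.
split => [a f h|]; first by rewrite hermPl.
exists (T * qf q g) => f.
apply: le_trans (cauchy_schwarz hq (@subspaceT _ V) pq I I) _.
rewrite mulrAC; apply: ler_wpM2r; first exact: pq.
exact: (qf_le_trace hH hq qT).
Qed.

Variables (S : set V) (e : nat -> V) (lam : nat -> R).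
Hypotheses (hS : subspace S) (cS : qclosed dot S) (sp : spectral dot q T S e lam).
Hypothesis pos : forall j, 0 < eps - l * lam j.

Let mu j := lam j / (eps - l * lam j).

(** For [l >= 0] the worst case is the largest eigenvalue [lam 0]; for [l < 0] the term in [q] only
    helps. This is the substitute for invertibility of the form. *)
Lemma barrier_coercive : exists2 c : R, 0 < c &
  forall f, S f -> c * qf dot f <= qf barrier f.
Proof.
have key f : S f -> qf q f <= lam 0%N * qf dot f by move=> Sf; exact: (sp_max sp).
have d0 f : 0 <= qf dot f by exact: pd.
have q0 f : 0 <= qf q f by exact: pq.
have [l0|l0] := leP 0 l.
  exists (eps - l * lam 0%N) => // f Sf; rewrite qf_barrier mulrBl lerD2l lerN2.
  by rewrite -mulrA ler_wpM2l // key.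
exists eps => // f Sf; rewrite qf_barrier lerDl oppr_ge0.
by rewrite nmulr_rle0.
Qed.

Lemma barrier_ge0 : psd_on S barrier.
Proof.
have [c c0 H] := barrier_coercive => f Sf; apply: le_trans (H f Sf).
by apply: mulr_ge0; [exact: ltW|exact: pd].
Qed.

Lemma barrier_eig j f : S f ->
  barrier f (e j) = (eps - l * lam j)%:C * dot f (e j).
Proof.
move=> Sf; rewrite /barrier (sp_eig sp) // rmorphB rmorphM /= mulrBl.
by rewrite mulrA.
Qed.

(** Expand [q] along the [e j] and exchange the sums. Bessel's inequality for [barrier], applied to
    [e j], bounds the sum of [|<h, e j>|^2] over [s] by [1 / (eps - l * lam j)]; the remainder
    carries the factor [lam n], which tends to 0. *)
Lemma barrier_trace s phi : orthon barrier s -> (forall h, h \in s -> S h) ->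
  (forall n, \sum_(0 <= j < n) mu j <= phi) -> \sum_(h <- s) qf q h <= phi.
Proof.
move=> os Ss hphi.
have key n : \sum_(h <- s) qf q h <= phi + lam n * \sum_(h <- s) qf dot h.
  apply: (@le_trans _ _ (\sum_(h <- s) (\sum_(0 <= j < n) lam j * sqn (dot h (e j))
      + lam n * qf dot h))).
    rewrite big_seq [leRHS]big_seq; apply: ler_sum => h hs.
    have := parseval hH hq pq hS sp n (Ss _ hs); lra.
  rewrite big_split /= -mulr_sumr lerD2r exchange_big /=.
  apply: le_trans (hphi n); apply: ler_sum => j _.
  rewrite -mulr_sumr; apply: ler_wpM2l; first exact: (sp_ge0 sp).
  rewrite -(ler_pM2l (pos j)) mulfV ?gt_eqF // -(ler_pM2l (pos j)) mulr1.
  have := bessel herm_barrier hS barrier_ge0 os Ss (sp_mem sp j).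
  have -> : qf barrier (e j) = (eps - l * lam j) * qf dot (e j).
    by rewrite qf_barrier (sp_qf sp) mulrBl -mulrA (sp_lamM sp).
  move=> hb; apply: (@le_trans _ _ ((eps - l * lam j) * qf dot (e j))).
    apply: le_trans hb; rewrite !mulr_sumr big_seq [leRHS]big_seq.
    apply: ler_sum => h hs.
    rewrite (hermC herm_barrier h (e j)) sqn_conj (barrier_eig j (Ss _ hs)).
    by rewrite (sqnM (eps - l * lam j)%:C) sqn_real mulrA -expr2.
  have /andP[_ ?] := sp_qf_le1 hH sp j.
  by rewrite ger_pMr.
apply/ler_addgt0Pr => eta eta0.
have s0 : 0 <= \sum_(h <- s) qf dot h by apply: sumr_ge0 => h _; exact: pd.
have s1 : 0 < \sum_(h <- s) qf dot h + 1 by rewrite ltr_wpDl.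
have [N hN] := sp_lim0 hH qT sp (divr_gt0 eta0 s1).
apply: le_trans (key N) _; rewrite lerD2l.
have := hN N (leqnn _); rewrite ler_pdivlMr //; apply: le_trans.
by apply: ler_wpM2l; [exact: (sp_ge0 sp)|rewrite lerDl].
Qed.

Variable k : V.
Hypothesis hk : forall f, S f -> qf q f = 0 -> dot f k = 0.

Let w j := (eps - l * lam j)^-1.
Let t j := sqn (dot k (e j)) / (eps - l * lam j).

(** The witness is the inverse of [barrier] applied to [k], that is the series of the
    [w j * <k, e j>] times [e j]. Formally [barrier g g] is the sum of the [t j] and [q g g] that of
    the [mu j * t j]; one inequality of each suffices. A component of [k] along null vectors of [q]
    would escape the series, and [hk] excludes it. *)
Lemma barrier_riesz : exists g, [/\ S g,
  forall f, S f -> dot f k = barrier f g,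
  forall n, \sum_(0 <= j < n) mu j * t j <= qf q g &
  forall b, (forall n, \sum_(0 <= j < n) t j <= b) -> qf barrier g <= b].
Proof.
have [c c0 hc] := barrier_coercive.
pose a j := (w j)%:C * dot k (e j).
have w0 j : 0 < w j by rewrite invr_gt0.
have wM j : w j * (eps - l * lam j) = 1 by rewrite mulVf ?gt_eqF.
have wc j : sqn (a j) * qf dot (e j) <= c^-1 ^+ 2 * sqn (dot k (e j)).
  rewrite /a sqnM sqn_real; case: (sp_one sp j) => [e1|->]; last first.
    by rewrite qf0 // herm0r // sqn0 !mulr0.
  have q1 : qf dot (e j) = 1 by rewrite /qf e1.
  rewrite q1 mulr1; apply: ler_wpM2r; first exact: sqn_ge0.
  have wle : w j <= c^-1.
    rewrite lef_pV2 ?posrE //; have := hc _ (sp_mem sp j).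
    by rewrite qf_barrier (sp_qf sp) q1 !mulr1.
  have w0' := ltW (w0 j); rewrite ler_sqr // nnegrE; exact: le_trans wle.
have [|g Sg ag] := riesz_fischer hH hS cS sp (a := a) (C := c^-1 ^+ 2 * qf dot k).
  move=> n; apply: (@le_trans _ _ (\sum_(0 <= j < n) c^-1 ^+ 2 * sqn (dot k (e j)))).
    by apply: ler_sum.
  rewrite -mulr_sumr; apply: ler_wpM2l; first exact: sqr_ge0.
  exact: (sp_bessel hH sp).
have ge j : dot g (e j) = a j.
  rewrite (dot_qlim hH sp j ag) /a; case: (sp_one sp j) => ->.
    by rewrite mulr1.
  by rewrite !(herm0r hd) !mulr0.
have gF f : S f -> dot f k = barrier f g.
  move=> Sf; apply/eqP; rewrite -subr_eq0; apply/eqP.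
  pose F f := 1 * dot f k + (-1) * (eps%:C * dot f g + (- l%:C) * q f g).
  have -> : dot f k - barrier f g = F f by rewrite /F /barrier; ring.
  apply: (density hH pq qT hS cS sp (F := F)) => //.
  - apply: bounded_functionalD; first exact: (dot_bounded hH).
    by apply: bounded_functionalD; [exact: (dot_bounded hH)|exact: q_bounded].
  - move=> j; rewrite /F.
    have -> : q (e j) g = (lam j)%:C * dot (e j) g.
      by rewrite (hermC hq) (sp_eig sp) // conjM conj_real -(hermC hd).
    rewrite (hermC hd g) ge /a conjM conj_real -(hermC hd k).
    have : (w j)%:C * (eps%:C - l%:C * (lam j)%:C) = 1 :> R[i].
      rewrite -(rmorphM (real_complex R)) -(rmorphB (real_complex R)).
      by rewrite -(rmorphM (real_complex R)) wM.
    set W := (w j)%:C; set D := dot (e j) k => WE.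
    have -> : 1 * D + -1 * (eps%:C * (W * D) + - l%:C * ((lam j)%:C * (W * D))) =
      D * (1 - W * (eps%:C - l%:C * (lam j)%:C)) by ring.
    by rewrite WE subrr mulr0.
  - move=> x Sx qx; rewrite /F hk //.
    have qx0 h : q x h = 0.
      by apply: (herm_eq0C hq); exact: (psd_null hq (@subspaceT _ V) pq I I).
    rewrite qx0 (hermC hd g).
    (* [g] is a limit of combinations of eigenvectors with [lam j > 0], and
       [lam j * dot x (e j) = q x (e j) = 0] makes these orthogonal to [x]. *)
    have -> : dot g x = 0.
      apply: (functional_lim (N := 0) hH (dot_bounded hH x) ag) => n _.
      rewrite herm_suml // big1 // => j _; rewrite hermZl //.
      have : (lam j)%:C * dot x (e j) = 0 by rewrite -(sp_eig sp) // qx0.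
      case: (sp_unit sp j) => [[lj _]|[_ ->]]; last by rewrite herm0l // mulr0.
      move/eqP; rewrite mulf_eq0 => /orP[/eqP[l0]|/eqP /(herm_eq0C hd) ->].
        by rewrite l0 ltxx in lj.
      by rewrite mulr0.
    by rewrite conj0; ring.
exists g; split => //.
  move=> n; have := parseval hH hq pq hS sp n Sg => /andP[+ _].
  rewrite subr_ge0; apply: le_trans; apply: ler_sum => j _.
  rewrite ge /a sqnM sqn_real /mu /t /w le_eqVlt; apply/orP; left.
  by apply/eqP; ring.
move=> b hb.
have -> : qf barrier g = complex.Re (dot g k) by rewrite gF.
have pk n : complex.Re (dot (\sum_(0 <= j < n) a j *: e j) k) = \sum_(0 <= j < n) t j.
  rewrite herm_suml // Re_sum; apply: eq_bigr => j _.
  rewrite hermZl // /a -mulrA (hermC hd k) mul_conj_sqn Re_rM /=.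
  by rewrite /t mulrC.
apply/ler_addgt0Pr => eta eta0.
pose r := eta / (qf dot k + 1).
have k0 : 0 <= qf dot k by exact: pd.
(* At this distance Cauchy-Schwarz moves the pairing with [k] by at most [eta]. *)
have r0 : 0 < eta ^+ 2 / (qf dot k + 1) by rewrite divr_gt0 ?exprn_gt0 // ltr_wpDl.
have [N hN] := ag _ r0.
have /hN gN := leqnn N.
set p := \sum_(0 <= j < N) a j *: e j in gN.
have : complex.Re (dot (g - p) k) <= eta.
  rewrite leNgt; apply/negP => lt.
  have : eta ^+ 2 < sqn (dot (g - p) k).
    rewrite /sqn; apply: (@lt_le_trans _ _ (complex.Re (dot (g - p) k) ^+ 2)).
      by rewrite ltr_sqr ?nnegrE ?ltW //; exact: lt_trans lt.
    by rewrite lerDl sqr_ge0.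
  apply/negP; rewrite -leNgt.
  apply: le_trans (cauchy_schwarz hd (@subspaceT _ V) pd I I) _.
  move: gN; rewrite ler_pdivlMr ?ltr_wpDl //; apply: le_trans.
  by apply: ler_wpM2l; [exact: pd|rewrite lerDl].
rewrite hermBl // ReD ReN pk; have := hb N; lra.
Qed.

(* The sum of [lam' j / (eps - l * lam' j)] is the trace of [q] relative to
   [barrier]; cutting [S] by [dot f k = 0] removes one direction from it, namely
   the vector representing [dot^~ k] in [barrier]. *)
Lemma barrier_cut (phi th : R) : (forall n, \sum_(0 <= j < n) mu j <= phi) ->
  (forall e' lam', spectral dot q T (S `&` [set f | dot f k = 0]) e' lam' ->
    (forall j, 0 < eps - l * lam' j) /\
    forall n, \sum_(0 <= j < n) lam' j / (eps - l * lam' j) <= phi - th) \/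
  (forall n b, (forall m, \sum_(0 <= j < m) t j <= b) ->
    0 <= th -> \sum_(0 <= j < n) mu j * t j <= th * b).
Proof.
move=> hphi; have [c c0 hc] := barrier_coercive.
have [g [Sg gF glow gup]] := barrier_riesz.
(* Either the direction of [g] carries more than [th] of the trace, and the cut removes it, or the
   reverse inequality is handed on to be integrated over the points. *)
have [qg|qg] := leP (qf q g) (th * qf barrier g).
  right => n b hb th0; apply: le_trans (glow n) _; apply: le_trans qg _.
  by apply: ler_wpM2l => //; exact: gup.
left => e' lam' sp'.
have dpos j : 0 < eps - l * lam' j.
  have [[l0 e1]|[-> _]] := sp_unit sp' j; last by rewrite mulr0 subr0.
  have q1 : qf dot (e' j) = 1 by rewrite /qf e1.
  have [Sej _] := sp_mem sp' j.
  have := hc _ Sej; rewrite qf_barrier (sp_qf sp') q1 !mulr1.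
  exact: lt_le_trans.
split => // n.
have hB := herm_barrier.
pose b := qf barrier g.
have b0 : 0 < b.
  rewrite lt_def; apply/andP; split; last exact: barrier_ge0.
  apply/eqP => bE; have := hc _ Sg; rewrite -/b bE pmulr_rle0 // => g0.
  have /eqP : qf dot g == 0 by rewrite eq_le g0; exact: pd.
  case: hH => _ _ H _ /H gz; move: qg; rewrite gz qf0 // qf0 //.
  by rewrite mulr0 ltxx.
(* On the cut subspace [barrier f g = dot f k = 0], so [g] can be joined to the eigenvectors of that
   subspace. Normalised, they form one orthonormal family for [barrier] in [S], to which
   [barrier_trace] applies. *)
pose u := (Num.sqrt b)^-1%:C *: g.
pose v j := (Num.sqrt (eps - l * lam' j))^-1%:C *: e' j.
have eB i j : barrier (e' i) (e' j) = (eps - l * lam' j)%:C * dot (e' i) (e' j).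
  rewrite /barrier (sp_eig sp') ?rmorphB ?rmorphM /= ?mulrBl ?mulrA //.
  exact: (sp_mem sp').
have v1 j : barrier (v j) (v j) = 1 \/ v j = 0.
  case: (sp_one sp' j) => [e1|ej]; [left|by right; rewrite /v ej scaler0].
  rewrite /v hermZl // hermZr // eB e1 mulr1 conj_real -!(rmorphM (real_complex R)).
  by rewrite mulrA -expr2 exprVn sqr_sqrtr ?ltW // mulVf // gt_eqF.
have v0 i j : i != j -> barrier (v i) (v j) = 0.
  move=> ij; rewrite /v hermZl // hermZr // eB (sp_orth sp') //.
  by rewrite !mulr0.
have u1 : barrier u u = 1.
  rewrite /u hermZl // hermZr // (qfE hB) conj_real -!(rmorphM (real_complex R)).
  by rewrite mulrA -expr2 exprVn sqr_sqrtr ?ltW // mulVf // gt_eqF.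
have os : orthon barrier (u :: map v (iota 0 n)).
  split; [by left| |exact: orthon_map_iota].
  move=> _ /mapP[j _ ->]; rewrite /u /v hermZl // hermZr //.
  apply/eqP; rewrite !mulf_eq0; apply/orP; right; apply/orP; right; apply/eqP.
  apply: (herm_eq0C hB); have [Sej /= ek] := sp_mem sp' j.
  by rewrite -gF.
have Su h : h \in u :: map v (iota 0 n) -> S h.
  rewrite inE => /orP[/eqP ->|/mapP[j _ ->]]; apply: subspaceZ => //.
  by have [] := sp_mem sp' j.
have := barrier_trace os Su hphi.
rewrite big_cons.
have -> : \sum_(h <- map v (iota 0 n)) qf q h =
    \sum_(0 <= j < n) lam' j / (eps - l * lam' j).
  rewrite big_map /index_iota subn0; apply: eq_bigr => j _.
  by rewrite /v qfZ // sqn_real exprVn sqr_sqrtr ?ltW // (sp_qf sp') mulrC.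
rewrite /u qfZ // sqn_real exprVn sqr_sqrtr; last exact: ltW.
suff : th < b^-1 * qf q g by lra.
by rewrite mulrC ltr_pdivlMr.
Qed.

End potential.

(** * Singular numbers *)

Section dimension.
Context {R : realType} {H : completeNormedModType R[i]}.
Implicit Types (S : set H) (W : H -> H).

(** If [m' < m], the coefficient matrix of [b] over [b'] has a nonzero left kernel vector, which is
    a linear relation among the [b i]. *)
Lemma has_dim_le S m m' : has_dim S m -> has_dim S m' -> (m <= m')%N.
Proof.
move=> [b [bfree bS]] [b' [_ b'S]].
have /choice[A hA] : forall i : 'I_m, exists a : 'I_m' -> R[i],
    b i = \sum_(k < m') a k *: b' k.
  move=> i; have : S (b i).
    rewrite bS; exists (fun j => (j == i)%:R) => //.
    rewrite (bigD1 i) //= eqxx scale1r big1 ?addr0 // => j /negbTE ->.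
    by rewrite scale0r.
  by rewrite b'S => -[a _ <-]; exists a.
rewrite leqNgt; apply/negP => lt.
pose M := \matrix_(i < m, k < m') A i k.
have /rowV0Pn[v vK vN0] : kermx M != 0.
  rewrite kermx_eq0; apply: contraL lt; rewrite /row_free => /eqP <-.
  by rewrite -leqNgt rank_leq_col.
move/eqP: vN0; apply; apply/rowP => i; rewrite mxE; apply: (bfree (v 0)).
have vM : v *m M = 0 by apply/sub_kermxP.
transitivity (\sum_(k < m') (v *m M) 0 k *: b' k).
  under eq_bigr do rewrite hA scaler_sumr.
  rewrite exchange_big /=; apply: eq_bigr => k _.
  rewrite mxE scaler_suml; apply: eq_bigr => j _.
  by rewrite mxE scalerA.
by rewrite big1 // => k _; rewrite vM mxE scale0r.
Qed.

Lemma has_dim_uniq S m m' : has_dim S m -> has_dim S m' -> m = m'.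
Proof.
by move=> h h'; apply/eqP; rewrite eqn_leq (has_dim_le h h') (has_dim_le h' h).
Qed.

(** If [s2 j < s1 j], every index at which [s2] takes the value [s1 j] is below [j], where both
    sequences agree. Then [s1] takes this value at all those indices and at [j] as well, although
    both counts equal the dimension of one eigenspace. *)
Lemma singular_numbers_le W (s1 s2 : nat -> R) j :
  singular_numbers_of W s1 -> singular_numbers_of W s2 ->
  (forall i, (i < j)%N -> s1 i = s2 i) -> s1 j <= s2 j.
Proof.
move=> [p1 n1 d1] [p2 n2 d2] eq12; rewrite leNgt; apply/negP => lt.
have l0 : 0 < s1 j ^+ 2 by rewrite exprn_gt0 // (le_lt_trans (p2 j)).
have [m [dm c1]] := d1 _ l0; have [m' [dm' c2]] := d2 _ l0.
rewrite (has_dim_uniq dm' dm) {dm'} in c2.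
have fin (A : set nat) : (A #= `I_m)%card -> finite_set A.
  by move=> cA; apply/finite_setP; exists m.
set A1 := [set _ | _] in c1; set A2 := [set _ | _] in c2.
pose l1 := finmap.enum_fset (fset_set A1); pose l2 := finmap.enum_fset (fset_set A2).
have i1 i : (i \in l1) = (i \in A1) by exact: (in_fset_set (fin _ c1)).
have i2 i : (i \in l2) = (i \in A2) by exact: (in_fset_set (fin _ c2)).
have A2j i : A2 i -> (i < j)%N.
  move=> /= s2i; rewrite ltnNge; apply/negP => ji.
  have : s2 i = s1 j.
    by apply/eqP; rewrite -(@eqrXn2 _ 2%N) ?p1 ?p2 // s2i.
  by move=> e; have := n2 _ _ ji; rewrite e leNgt lt.
have : (size (j :: l2) <= size l1)%N.
  apply: uniq_leq_size.
    rewrite /= finmap.fset_uniq andbT i2; apply/negP => /set_mem /A2j.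
    by rewrite ltnn.
  move=> i; rewrite inE => /orP[/eqP ->|]; rewrite i1; first exact: mem_set.
  by rewrite i2 => /set_mem h; apply: mem_set; rewrite /A1 /= eq12 //; exact: A2j.
by rewrite /= (card_fset_set c1) (card_fset_set c2) ltnn.
Qed.

Lemma singular_numbers_uniq W (s1 s2 : nat -> R) :
  singular_numbers_of W s1 -> singular_numbers_of W s2 -> s1 =1 s2.
Proof.
move=> h1 h2 j; elim/ltn_ind: j => j ih.
apply/eqP; rewrite eq_le (singular_numbers_le h1 h2) //=.
by apply: singular_numbers_le h2 h1 _ => i /ih.
Qed.

Variables (dot q : H -> H -> R[i]) (T : R).
Hypothesis hH : hilbert_form dot.
Hypotheses (hq : herm q) (pq : psd_on setT q).
Hypothesis qT : forall s, orthon dot s -> \sum_(h <- s) qf q h <= T.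

(** The vector is given by its eigenvector series, with coefficients [lam j * dot f (e j)], and
    [density] verifies it. *)
Lemma adjoint_exists e lam f : spectral dot q T setT e lam ->
  exists h, forall g, dot g h = q g f.
Proof.
move=> sp; have hd : herm dot by case: hH.
have pd : psd_on setT dot by case: hH.
have cT : qclosed dot setT by [].
pose a j := (lam j)%:C * dot f (e j).
have a1 j : sqn (a j) * qf dot (e j) <= lam 0%N ^+ 2 * sqn (dot f (e j)).
  rewrite /a sqnM sqn_real; have /andP[e0 e1] := sp_qf_le1 hH sp j.
  apply: (@le_trans _ _ (lam j ^+ 2 * sqn (dot f (e j)))).
    by rewrite ler_piMr // mulr_ge0 ?sqr_ge0 ?sqn_ge0.
  apply: ler_wpM2r; first exact: sqn_ge0.
  have l0 := sp_ge0 sp; rewrite ler_sqr ?nnegrE ?l0 //.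
  exact: (sp_noninc hH sp).
have [|h _ ah] := riesz_fischer hH (@subspaceT _ H) cT sp (a := a)
    (C := lam 0%N ^+ 2 * qf dot f).
  move=> n; apply: le_trans (ler_sum _ (fun j _ => a1 j)) _.
  rewrite -mulr_sumr; apply: ler_wpM2l; first exact: sqr_ge0.
  exact: (sp_bessel hH sp).
exists h => g; apply/eqP; rewrite -subr_eq0; apply/eqP.
pose F g := 1 * dot g h + (-1) * q g f.
have -> : dot g h - q g f = F g by rewrite /F; ring.
apply: (density hH pq qT (@subspaceT _ H) cT sp (F := F)) => //.
- apply: bounded_functionalD; first exact: (dot_bounded hH).
  exact: (q_bounded hH hq pq qT).
- move=> j; rewrite /F (hermC hd h) (dot_qlim hH sp j ah) (hermC hq f) (sp_eig sp) //.
  rewrite /a; case: (sp_one sp j) => ->; first by rewrite mulr1 mul1r mulN1r subrr.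
  by rewrite !(herm0r hd) !mulr0 conj0 !mulr0 addr0.
- move=> x _ qx.
  have qx0 z : q x z = 0.
    by apply: (herm_eq0C hq); exact: (psd_null hq (@subspaceT _ H) pq I I).
  rewrite /F qx0 (hermC hd h).
  have -> : dot h x = 0; last by rewrite conj0; ring.
  apply: (functional_lim (N := 0) hH (dot_bounded hH x) ah) => n _.
  rewrite herm_suml // big1 // => j _; rewrite hermZl // /a.
  have := sp_eig sp j (I : [set: H] x); rewrite qx0 => /esym le0.
  have : (lam j)%:C * dot (e j) x = 0.
    by rewrite (hermC hd x) -[X in X * _]conj_real -conjM le0 conj0.
  by rewrite mulrAC => ->; rewrite mul0r.
Qed.

Lemma spectral_singular W e lam : spectral dot q T setT e lam ->
  (forall f g, dot g (W f) = q g f) ->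
  singular_numbers_of W (fun j => Num.sqrt (lam j)).
Proof.
move=> sp hW; have hd : herm dot by case: hH.
have dot0 f : qf dot f = 0 -> f = 0 by case: hH => _ _ + _; apply.
have l0 := sp_ge0 sp.
split=> [j|i j ij|la la0]; first exact: sqrtr_ge0.
  by apply: ler_wsqrtr; exact: (sp_noninc hH sp).
pose A := [set j | lam j = la].
have -> : [set j | Num.sqrt (lam j) ^+ 2 = la] = A.
  by apply/seteqP; split => j /=; rewrite sqr_sqrtr.
have finA : finite_set A.
  have [N hN] := sp_lim0 hH qT sp (divr_gt0 la0 (ltr0Sn R 1)).
  apply: sub_finite_set (finite_II N) => j /= lj; rewrite ltnNge; apply/negP.
  by move/hN; rewrite lj; lra.
have [m Am] := (finite_setP A).1 finA; exists m; split => //.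
have /card_set_bijP[b [bA binj bsurj]] := card_esym Am.
have lb (i : 'I_m) : lam (b i) = la by apply: bA => /=.
have e1 (i : 'I_m) : dot (e (b i)) (e (b i)) = 1.
  by case: (sp_unit sp (b i)) => -[] //; rewrite lb => lz; rewrite lz ltxx in la0.
have orth (i j : 'I_m) : i != j -> dot (e (b i)) (e (b j)) = 0.
  move=> ij; apply: (sp_orth sp); apply: contra_neq ij => bij.
  by apply/val_inj/binj => //; apply: mem_set => /=.
have dsum (a : 'I_m -> R[i]) (j : 'I_m) :
    dot (\sum_(i < m) a i *: e (b i)) (e (b j)) = a j.
  rewrite herm_suml // (bigD1 j) //= hermZl // e1 mulr1 big1 ?addr0 // => i ij.
  by rewrite hermZl // orth // mulr0.
exists (fun i => e (b i)); split.
  by move=> a a0 i; rewrite -dsum a0 herm0l.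
apply/seteqP; split => f /=; last first.
  move=> [a _ <-]; rewrite /eigenspace /=.
  set g := \sum_(i < m) _.
  have key h : dot h (W g) = dot h (la%:C *: g).
    rewrite hW hermZr // conj_real {}/g.
    rewrite (hermC hq (\sum_(i < m) _)) herm_suml //.
    rewrite (hermC hd (\sum_(i < m) _)) herm_suml //.
    rewrite -[la%:C in RHS]conj_real -conjM mulr_sumr; congr (Num.conj _).
    apply: eq_bigr => i _; rewrite !hermZl // (hermC hq h) (sp_eig sp) //.
    by rewrite conjM conj_real lb -(hermC hd h); ring.
  apply/eqP; rewrite -subr_eq0; apply/eqP/dot0.
  by rewrite /qf hermBr // key subrr.
rewrite /eigenspace /= => Wf.
exists (fun i => dot f (e (b i))) => //.
set p := \sum_(i < m) _.
suff : f - p = 0 by move/eqP; rewrite subr_eq0 => /eqP.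
(* Outside the eigenvalue [la] the coefficients of [f] vanish, so [f - p] is orthogonal to all [e j]
   and null for [q]. As [la * dot (f - p) f = q (f - p) f = 0] with [la > 0], it is orthogonal to
   [f] and to [p], hence 0. *)
have fj j : (lam j)%:C * dot f (e j) = la%:C * dot f (e j).
  rewrite -(sp_eig sp) // (hermC hq) -hW Wf hermZr // conjM.
  by rewrite conj_real conj_real -(hermC hd (e j)).
have rj j : dot (f - p) (e j) = 0.
  have [lj|lj] := eqVneq (lam j) la.
    have [i im ij] := bsurj j lj.
    by rewrite -ij hermBl // (dsum _ (Ordinal im)) subrr.
  have f0 : dot f (e j) = 0.
    move/eqP: (fj j); rewrite -subr_eq0 -mulrBl mulf_eq0 => /orP[|/eqP //].
    rewrite -(rmorphB (real_complex R)) => /eqP[] /eqP.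
    by rewrite subr_eq0 (negbTE lj).
  rewrite hermBl // f0 /p herm_suml // big1 ?subrr // => i _.
  rewrite hermZl // (sp_orth sp) ?mulr0 //.
  by apply: contra_neq lj => <-.
have q0 : qf q (f - p) = 0 by exact: (sp_null hH pq qT sp).
have d0 : dot (f - p) f = 0.
  have : la%:C * dot (f - p) f = 0.
    rewrite -[la%:C]conj_real -hermZr // -Wf hW; apply: (herm_eq0C hq).
    exact: (psd_null hq (@subspaceT _ H) pq I I).
  move/eqP; rewrite mulf_eq0 => /orP[/eqP[] lz|/eqP //].
  by rewrite lz ltxx in la0.
apply: dot0; rewrite /qf hermBr // d0 /p herm_sumr // big1 ?subrr // => i _.
by rewrite hermZr // rj mulr0.
Qed.

End dimension.

(** * The embedding into L_2 *)

Section L2_forms.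
Context {R : realType} {d : measure_display} {T : measurableType d}.
Variables (D : set T) (mu : {measure set T -> \bar R}).
Hypothesis mD : measurable D.
Implicit Types u v : T -> R[i].

(* [integral] is a supremum over the simple functions below the integrand, so
   that monotonicity does not require the larger function to be measurable. *)
Lemma ge0_le_integral_nonmeasurable (f g : T -> \bar R) :
  (forall x, D x -> (0 <= f x)%E) -> (forall x, D x -> (f x <= g x)%E) ->
  (\int[mu]_(x in D) f x <= \int[mu]_(x in D) g x)%E.
Proof.
move=> f0 fg.
have nnE (h : T -> \bar R) : (forall x, D x -> (0 <= h x)%E) ->
    ((h \_ D)^\- = cst 0)%E /\ ((h \_ D)^\+ = h \_ D)%E.
  move=> h0; have h0' x : (0 <= (h \_ D) x)%E.
    by rewrite patchE; case: ifPn => // /set_mem; exact: h0.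
  by split; apply/funext => x;
    rewrite ?(ge0_funenegE (D := setT)) ?(ge0_funeposE (D := setT)) ?inE.
have g0 x : D x -> (0 <= g x)%E.
  by move=> Dx; apply: le_trans (fg _ Dx); exact: f0.
rewrite /integral; have [-> ->] := nnE _ f0; have [-> ->] := nnE _ g0.
apply: leeB => //; apply: ge_ereal_sup => _ [h hf <-].
apply: ereal_sup_ubound; exists h => //= x; apply: le_trans (hf x) _.
by rewrite !patchE; case: ifPn => // /set_mem; exact: fg.
Qed.

Definition sqint u : \bar R := (\int[mu]_(x in D) (sqn (u x))%:E)%E.

Lemma L2normE u : L2norm D mu u = (sqint u `^ 2^-1)%E.
Proof.
rewrite /L2norm /sqint; congr (_ `^ _)%E.
by apply: eq_integral => x _; rewrite normr_sqn.
Qed.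

Lemma sqint_ge0 u : (0 <= sqint u)%E.
Proof. by apply: integral_ge0 => x _; rewrite lee_fin sqn_ge0. Qed.

Lemma L2norm_fin u : (sqint u < +oo)%E ->
  L2norm D mu u = (Num.sqrt (fine (sqint u)))%:E.
Proof.
move=> u1; rewrite L2normE.
have uf : sqint u \is a fin_num by rewrite ge0_fin_numE ?sqint_ge0.
by rewrite -{1}(fineK uf) poweR_EFin powR12_sqrt // fine_ge0 // sqint_ge0.
Qed.

Lemma measurable_sqn u : cmeasurable D u ->
  measurable_fun D (EFin \o (fun x => sqn (u x))).
Proof.
move=> [mr mi]; apply/measurable_EFinP.
by apply: measurable_funD; apply: measurable_funX.
Qed.

Definition sq_integrable u := cmeasurable D u /\ (sqint u < +oo)%E.

Lemma integrable_sqn u : sq_integrable u ->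
  mu.-integrable D (EFin \o (fun x => sqn (u x))).
Proof.
move=> [mu1 u1]; apply/integrableP; split; first exact: measurable_sqn.
apply: le_lt_trans u1; apply: ge0_le_integral_nonmeasurable => // x _.
by rewrite /= lee_fin ger0_norm // sqn_ge0.
Qed.

Lemma integrable_dominated u v (f : T -> R) : measurable_fun D f ->
  sq_integrable u -> sq_integrable v ->
  (forall x, D x -> `|f x| <= sqn (u x) + sqn (v x)) ->
  mu.-integrable D (EFin \o f).
Proof.
move=> mf hu hv fuv.
have := integrableD mD (integrable_sqn hu) (integrable_sqn hv).
apply: le_integrable => //; first exact/measurable_EFinP.
move=> x Dx; rewrite /= lee_fin; apply: le_trans (fuv x Dx) _.
exact: ler_norm.
Qed.

Lemma integrable_re u v : sq_integrable u -> sq_integrable v ->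
  mu.-integrable D (EFin \o (fun x => complex.Re (u x * Num.conj (v x)))).
Proof.
move=> hu hv; apply: (integrable_dominated _ hu hv).
  have -> : (fun x => complex.Re (u x * Num.conj (v x))) =
      (fun x => complex.Re (u x) * complex.Re (v x) +
                complex.Im (u x) * complex.Im (v x)).
    by apply/funext => x; case: (u x) (v x) => a b [a' b'] /=; ring.
  have [[? ?] _] := hu; have [[? ?] _] := hv.
  by apply: measurable_funD; apply: measurable_funM.
move=> x _; case: (u x) (v x) => a b [a' b']; rewrite /sqn /= ler_norml.
have := sqr_ge0 (a - a'); have := sqr_ge0 (b - b').
have := sqr_ge0 (a + a'); have := sqr_ge0 (b + b').
by move=> *; apply/andP; split; nra.
Qed.

Lemma integrable_im u v : sq_integrable u -> sq_integrable v ->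
  mu.-integrable D (EFin \o (fun x => complex.Im (u x * Num.conj (v x)))).
Proof.
move=> hu hv; apply: (integrable_dominated _ hu hv).
  have -> : (fun x => complex.Im (u x * Num.conj (v x))) =
      (fun x => complex.Im (u x) * complex.Re (v x) +
                - 1 * (complex.Re (u x) * complex.Im (v x))).
    by apply/funext => x; case: (u x) (v x) => a b [a' b'] /=; ring.
  have [[? ?] _] := hu; have [[? ?] _] := hv.
  apply: measurable_funD; first exact: measurable_funM.
  by apply: measurable_funM => //; apply: measurable_funM.
move=> x _; case: (u x) (v x) => a b [a' b']; rewrite /sqn /= ler_norml.
have := sqr_ge0 (a - b'); have := sqr_ge0 (b - a').
have := sqr_ge0 (a + b'); have := sqr_ge0 (b + a').
by move=> *; apply/andP; split; nra.
Qed.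

Lemma L2dotP (a : R[i]) u v w : sq_integrable u -> sq_integrable v ->
  sq_integrable w ->
  L2dot D mu (fun x => a * u x + v x) w = a * L2dot D mu u w + L2dot D mu v w.
Proof.
move=> hu hv hw; case: a => ar ai.
have ru := integrable_re hu hw; have iu := integrable_im hu hw.
have rv := integrable_re hv hw; have iv := integrable_im hv hw.
have rl (c1 c2 : R) : \int[mu]_(x in D) (c1 * complex.Re (u x * Num.conj (w x)) +
   c2 * complex.Im (u x * Num.conj (w x))) =
   c1 * \int[mu]_(x in D) complex.Re (u x * Num.conj (w x)) +
   c2 * \int[mu]_(x in D) complex.Im (u x * Num.conj (w x)).
  rewrite RintegralD //; last 2 first.
  - exact: (integrableZl mD c1 ru).
  - exact: (integrableZl mD c2 iu).
  by rewrite !RintegralZl.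
have il (c1 c2 : R) : mu.-integrable D (EFin \o (fun x =>
   c1 * complex.Re (u x * Num.conj (w x)) + c2 * complex.Im (u x * Num.conj (w x)))).
  exact: (integrableD mD (integrableZl mD c1 ru) (integrableZl mD c2 iu)).
apply/eqP; rewrite eq_complex /L2dot /=; apply/andP; split; apply/eqP.
  rewrite -mulNr -rl -RintegralD //; apply: eq_Rintegral => x _.
  by case: (u x) (v x) (w x) => ? ? [? ?] [? ?] /=; ring.
rewrite [ar * _ + _]addrC -rl -RintegralD //; apply: eq_Rintegral => x _.
by case: (u x) (v x) (w x) => ? ? [? ?] [? ?] /=; ring.
Qed.

Lemma L2dotC u v : sq_integrable u -> sq_integrable v ->
  L2dot D mu v u = Num.conj (L2dot D mu u v).
Proof.
move=> hu hv; apply/eqP; rewrite eq_complex /L2dot /=; apply/andP; split; apply/eqP.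
  by apply: eq_Rintegral => x _; case: (u x) (v x) => ? ? [? ?] /=; ring.
rewrite -mulN1r -RintegralZl //; last exact: integrable_im.
by apply: eq_Rintegral => x _; case: (u x) (v x) => ? ? [? ?] /=; ring.
Qed.

Lemma Re_L2dot u : complex.Re (L2dot D mu u u) = fine (sqint u).
Proof.
rewrite /L2dot /= /Rintegral /sqint; congr fine; apply: eq_integral => x _.
by rewrite mul_conj_sqn.
Qed.

End L2_forms.

(** * The reproducing kernel space with its trace-class L_2 form *)

Section embedding.
Context {R : realType} {d : measure_display} {T : measurableType d}.
Variables (D : set T) (mu : {measure set T -> \bar R}) (K : T -> T -> R[i]).
Context {H : completeNormedModType R[i]}.
Variables (dot : {dot H for Num.conj}) (ev : {linear H -> (T -> R[i])}).
Hypotheses (mD : measurable D) (rk : rkhs D dot ev K).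
Hypothesis mev : forall f, cmeasurable D (ev f).
Hypothesis KT : (\int[mu]_(x in D) (complex.Re (K x x))%:E < +oo)%E.

Let dotf : H -> H -> R[i] := dot.

Lemma dot_herm : herm dotf.
Proof.
split => [a f g h|f g]; rewrite /dotf; first by rewrite linearPl.
by rewrite sesquilinear.hermC expr0 mul1r.
Qed.

Lemma normr_dot (f : H) : `|f| = (Num.sqrt (qf dotf f))%:C.
Proof.
have [hd _ _] := rk.
have := hd f; rewrite -[dot f f]/(dotf f f) (qfE dot_herm) => e.
have n0 : 0 <= `|f| by [].
have [r rE] := complex_realP _ (ger0_real n0).
move: e n0; rewrite rE -(rmorphXn (real_complex R)) ler0c => -[] <- r0.
by rewrite sqrtr_sqr ger0_norm.
Qed.

Lemma qf_normr f : qf dotf f = complex.Re `|f| ^+ 2.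
Proof.
have [hd _ _] := rk.
rewrite normr_dot /= sqr_sqrtr // /qf /dotf -hd normr_dot.
by rewrite -(rmorphXn (real_complex R)) /= sqr_ge0.
Qed.

Lemma dot_psd : psd_on setT dotf.
Proof. by move=> f _; rewrite qf_normr sqr_ge0. Qed.

Lemma lt_normr (f : H) (e : R[i]) : 0 < e ->
  (`|f| < e) = (qf dotf f < complex.Re e ^+ 2).
Proof.
rewrite ltcE /= => /andP[/eqP ei e0]; rewrite normr_dot ltcE /= ei eqxx /=.
by rewrite -{2}[qf dotf f]sqr_sqrtr ?dot_psd // ltr_sqr ?nnegrE ?sqrtr_ge0 ?ltW.
Qed.

Lemma dot_hilbert : hilbert_form dotf.
Proof.
split; [exact: dot_herm|exact: dot_psd| |].
  move=> f f0; apply/eqP; rewrite -normr_eq0.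
  by rewrite normr_dot f0 sqrtr0.
move=> u cu.
have /cauchy_cvg cvu : cauchy (u @ \oo).
  apply: cauchy_exP => e e0.
  have re0 : 0 < complex.Re e by move: e0; rewrite ltcE => /andP[].
  have e2 : 0 < complex.Re e ^+ 2 / 2 by rewrite divr_gt0 // exprn_gt0.
  have [N hN] := cu _ e2; exists (u N); exists N => // n /= Nn.
  rewrite -ball_normE /= lt_normr //; apply: le_lt_trans (hN _ _ (leqnn N) Nn) _.
  by rewrite ltr_pdivrMr // ltr_pMr ?exprn_gt0 // ltr1n.
exists (lim (u @ \oo)) => eps eps0.
have s0 : 0 < (Num.sqrt eps)%:C by rewrite ltcR sqrtr_gt0.
have /cvgrPdist_lt /(_ _ s0) [N _ hN] := cvu.
exists N => n Nn; apply: ltW; have := hN n Nn; rewrite lt_normr //=.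
by rewrite sqr_sqrtr ?ltW.
Qed.

Lemma ev_linear a f g x : ev (a *: f + g) x = a * ev f x + ev g x.
Proof. by rewrite linearP. Qed.

Lemma kernel_section y : D y -> exists k, [/\ forall f, ev f y = dotf f k &
  qf dotf k = complex.Re (K y y)].
Proof.
move=> Dy; have [_ _ /(_ y Dy)[k [kK kd]]] := rk; exists k; split => //.
by rewrite /qf /dotf -kd kK.
Qed.

Lemma kernel_diag_ge0 x : D x -> 0 <= complex.Re (K x x).
Proof. by case/kernel_section => k [_ <-]; exact: dot_psd. Qed.

Definition trace_bound : R := fine (\int[mu]_(x in D) (complex.Re (K x x))%:E).

Lemma trace_boundE :
  (\int[mu]_(x in D) (complex.Re (K x x))%:E = trace_bound%:E)%E.
Proof.
rewrite /trace_bound fineK // ge0_fin_numE //.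
by apply: integral_ge0 => x Dx; rewrite lee_fin kernel_diag_ge0.
Qed.

Lemma measurable_evsq f : measurable_fun D (EFin \o (fun x => sqn (ev f x))).
Proof. exact: measurable_sqn. Qed.

(** Bessel's inequality for the kernel section at [x] bounds the sum of the [|h(x)|^2] by [K x x],
    for each [x] in [D]; the integrals are then compared. *)
Lemma sqint_sum_le s : orthon dotf s ->
  (\sum_(h <- s) sqint D mu (ev h) <= trace_bound%:E)%E.
Proof.
move=> os; rewrite -trace_boundE -ge0_integral_sum //; last 2 first.
- by move=> h; exact: measurable_evsq.
- by move=> h x _; rewrite lee_fin sqn_ge0.
apply: ge0_le_integral_nonmeasurable => x Dx.
  by apply: sume_ge0 => h _; rewrite lee_fin sqn_ge0.
rewrite sumEFin lee_fin; have [k [kd <-]] := kernel_section Dx.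
apply: le_trans (bessel dot_herm (@subspaceT _ H) dot_psd os (fun _ _ => I) I).
by apply: ler_sum => h _; rewrite kd (hermC dot_herm) sqn_conj.
Qed.

Lemma ev_sq_integrable f : sq_integrable D mu (ev f).
Proof.
split; first exact: mev.
have [->|f0] := eqVneq f 0.
  by rewrite /sqint integral0_eq // => x _; rewrite linear0 /= sqn0.
have [r [g [r2 g1 fE _]]] := unit_scale dot_hilbert f0.
have /sqint_sum_le : orthon dotf [:: g] by split => //; left.
rewrite big_seq1 => g2; rewrite /sqint.
have evE x : (sqn (ev f x))%:E = ((r ^+ 2)%:E * (sqn (ev g x))%:E)%E.
  rewrite fE -[_ *: g]addr0 ev_linear linear0 addr0 sqnM sqn_real.
  by rewrite EFinM.
under eq_integral do rewrite evE.
rewrite ge0_integralZl //; [|exact: measurable_evsq| |].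
- by apply: lte_mul_pinfty => //; rewrite ?lee_fin ?sqr_ge0 // (le_lt_trans g2) ?ltry.
- by move=> x _; rewrite lee_fin sqn_ge0.
- by rewrite lee_fin sqr_ge0.
Qed.

Definition L2form (f g : H) : R[i] := L2dot D mu (ev f) (ev g).

Lemma L2form_herm : herm L2form.
Proof.
split => [a f g h|f g]; rewrite /L2form.
  have -> : ev (a *: f + g) = (fun x => a * ev f x + ev g x).
    by apply/funext => x; exact: ev_linear.
  by apply: L2dotP => //; exact: ev_sq_integrable.
by apply: L2dotC => //; exact: ev_sq_integrable.
Qed.

Lemma qf_L2form f : qf L2form f = fine (sqint D mu (ev f)).
Proof. exact: Re_L2dot. Qed.

Lemma qf_L2formE f : ((qf L2form f)%:E = sqint D mu (ev f))%E.
Proof.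
by rewrite qf_L2form fineK // ge0_fin_numE ?sqint_ge0; case: (ev_sq_integrable f).
Qed.

Lemma L2norm_ev f : L2norm D mu (ev f) = (Num.sqrt (qf L2form f))%:E.
Proof. by rewrite qf_L2form L2norm_fin //; case: (ev_sq_integrable f). Qed.

Lemma L2form_psd : psd_on setT L2form.
Proof. by move=> f _; rewrite qf_L2form fine_ge0 // sqint_ge0. Qed.

Lemma L2form_trace s : orthon dotf s -> \sum_(h <- s) qf L2form h <= trace_bound.
Proof.
move=> /sqint_sum_le; rewrite -lee_fin -sumEFin.
by under [X in (X <= _ -> _)%E]eq_bigr do rewrite -qf_L2formE.
Qed.

End embedding.

(** * Choice of the sampling points *)

Lemma nneseries_le {R : realType} (u : nat -> \bar R) (P : pred nat) (c : \bar R) :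
  (forall n, P n -> (0 <= u n)%E) ->
  (forall N, (\sum_(0 <= i < N | P i) u i <= c)%E) ->
  (\sum_(0 <= i <oo | P i) u i <= c)%E.
Proof.
move=> u0 uc; apply: lime_le.
  by apply: is_cvg_nneseries_cond => n _; exact: u0.
exact: nearW.
Qed.

Section sampling.
Context {R : realType} {d : measure_display} {T : measurableType d}.
Variables (D : set T) (mu : {measure set T -> \bar R}) (K : T -> T -> R[i]).
Context {H : completeNormedModType R[i]}.
Variables (dot : {dot H for Num.conj}) (ev : {linear H -> (T -> R[i])}).
Hypotheses (mD : measurable D) (rk : rkhs D dot ev K).
Hypothesis mev : forall f, cmeasurable D (ev f).
Hypothesis KT : (\int[mu]_(x in D) (complex.Re (K x x))%:E < +oo)%E.
Hypothesis sepH : separable_space H.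

Let dotf : H -> H -> R[i] := dot.
Let q : H -> H -> R[i] := L2form D mu ev.
Let Tr : R := trace_bound D mu K.

Let hH : hilbert_form dotf := dot_hilbert rk.
Let hd : herm dotf := dot_herm dot.
Let pd : psd_on setT dotf := dot_psd rk.
Let hq : herm q := L2form_herm mD rk mev KT.
Let pq : psd_on setT q := @L2form_psd _ _ _ D mu _ ev.
Let qT : forall s, orthon dotf s -> \sum_(h <- s) qf q h <= Tr :=
  L2form_trace mD rk mev KT.

Lemma kernel_negligible f : qf q f = 0 ->
  mu.-negligible [set x | D x /\ ev f x != 0].
Proof.
move=> qf0; have mf := measurable_evsq mev f.
have /(ae_eq_integral_abs mu mD mf) : (\int[mu]_(x in D)
    `|(EFin \o (fun x => sqn (ev f x))) x| = 0)%E.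
  have := qf_L2formE mD rk mev KT f; rewrite -/q qf0 => e.
  rewrite [RHS]e /sqint; apply: eq_integral => x _.
  by rewrite /= ger0_norm // sqn_ge0.
apply: negligibleS => x /= [Dx fx] h; move: fx.
by have [/sqn_eq0 ->] := h Dx; rewrite eqxx.
Qed.

(** The exceptional set of a null vector depends on the vector. Separability reduces the matter to
    countably many null vectors, and continuity of evaluation extends the vanishing to all
    others. *)
Lemma null_points : exists2 Z : set T, mu.-negligible Z &
  forall x, D x -> ~ Z x -> forall f, qf q f = 0 -> ev f x = 0.
Proof.
have [S [/countable_injP[code codeI] denseS]] := sepH.
pose sigma n := xget 0 [set s | S s /\ code s = n].
have sigmaE s : S s -> sigma (code s) = s.
  move=> Ss; rewrite /sigma; case: xgetP => [s' -> [Ss' cs]|/(_ s)].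
    by apply: codeI; rewrite ?inE.
  by case; split.
(* The dense set need not contain null vectors of [q]. Near each of its points [p] selects one
   whenever there is one within the given distance, and 0 otherwise. *)
have /choice[p hp] : forall sn : H * nat, exists f : H, qf q f = 0 /\
    ((exists2 g, qf q g = 0 & qf dotf (g - sn.1) < sn.2.+1%:R^-1) ->
     qf dotf (f - sn.1) < sn.2.+1%:R^-1).
  move=> [s n]; have [[g g0 gs]|nog] := pselect (exists2 g, qf q g = 0 &
    qf dotf (g - s) < n.+1%:R^-1); first by exists g.
  by exists 0; split => //; exact: qf0.
exists (\bigcup_n \bigcup_m [set x | D x /\ ev (p (sigma n, m)) x != 0]).
  apply: negligible_bigcup => n; apply: negligible_bigcup => m.
  exact: kernel_negligible (hp _).1.
move=> x Dx nZ f f0.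
have [k [kd' _]] := kernel_section rk Dx.
have kd g : ev g x = dotf g k by exact: kd'.
rewrite kd.
apply: (qclosed_ker hH (dot_bounded hH k)) => eps eps0.
(* [s] is close to both [f] and [p (s, m)]; [qfD_le2] doubles each of the two squared distances. *)
have e4 : 0 < eps / 4 by rewrite divr_gt0.
have [m _ /(_ m (leqnn m)) /= hm] := near_infty_natSinv_lt (PosNum e4).
have m0 : 0 < m.+1%:R^-1 :> R by rewrite invr_gt0.
have r0 : 0 < (Num.sqrt (m.+1%:R^-1 : R))%:C by rewrite ltcR sqrtr_gt0.
have [s [Bs Ss]] : ball f (Num.sqrt (m.+1%:R^-1 : R))%:C `&` S !=set0.
  by apply: denseS; [exists f; exact: ballxx|exact: ball_open].
have fs : qf dotf (f - s) < m.+1%:R^-1.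
  by move: Bs; rewrite -ball_normE /= (lt_normr rk) //= sqr_sqrtr ?ltW.
have [g0 /(_ (ex_intro2 _ _ f f0 fs)) gs] := hp (s, m).
exists (p (s, m)).
  rewrite /= -kd; apply/eqP/negPn/negP => gx; apply: nZ.
  by exists (code s) => //; exists m => //; rewrite /= sigmaE.
have -> : f - p (s, m) = (f - s) + (s - p (s, m)) by rewrite addrA subrK.
apply: le_trans (qfD_le2 hd (@subspaceT _ H) pd I I) _.
have : qf dotf (s - p (s, m)) < m.+1%:R^-1 by rewrite qfBC.
move: fs hm; set r := m.+1%:R^-1; lra.
Qed.

(* As the barrier moves from [l] to [l + delta], the potential rises by at most
   [th].  If cutting at no point [x] outside the null set compensated for this,
   integrating the reverse inequality over [x] would give [S2 <= S2 / 2], where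
   [S2] is the sum of the [mu' j ^+ 2]. *)
Lemma potential_step (S : set H) e lam (eps l delta phi : R) :
  D !=set0 -> subspace S -> qclosed dotf S -> spectral dotf q Tr S e lam ->
  0 < eps -> 0 < delta -> 0 <= phi -> delta * phi <= 3^-1 ->
  (forall j, 0 < eps - l * lam j) ->
  (forall n, \sum_(0 <= j < n) lam j / (eps - l * lam j) <= phi) ->
  exists2 x, D x & forall e' lam',
    spectral dotf q Tr (S `&` [set f | ev f x = 0]) e' lam' ->
    (forall j, 0 < eps - (l + delta) * lam' j) /\
    forall n, \sum_(0 <= j < n) lam' j / (eps - (l + delta) * lam' j) <= phi.
Proof.
move=> D0 hS cS sp eps0 delta0 phi0 dphi pos hphi.
have lam0 := sp_ge0 sp.
(* If [lam 0 = 0], then [q] vanishes on [S] and any point of [D] will do. Otherwise [S2 > 0], which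
   the final contradiction requires. *)
have [l00|l0n] := eqVneq (lam 0%N) 0.
  have [x Dx] := D0; exists x => // e' lam' sp'.
  have l'0 j : lam' j = 0.
    apply/eqP; rewrite eq_le (sp_ge0 sp') andbT -(sp_qf sp').
    have [Se _] := sp_mem sp' j.
    by have := sp_max sp (n := 0) Se; rewrite l00 mul0r; apply.
  split=> [j|n]; first by rewrite l'0 mulr0 subr0.
  by rewrite big1 // => j _; rewrite l'0 mul0r.
have l0p : 0 < lam 0%N by rewrite lt_def l0n lam0.
pose dn j := eps - l * lam j.
pose dn' j := eps - (l + delta) * lam j.
pose mu' j := lam j / dn' j.
have dnE j : dn' j = dn j - delta * lam j by rewrite /dn' /dn; ring.
have posd j : 0 < dn j by exact: pos.
have mu0 j : 0 <= lam j / dn j by rewrite divr_ge0 // ltW.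
have mu1 j : lam j <= phi * dn j.
  rewrite -ler_pdivrMr //; apply: le_trans (hphi j.+1).
  by rewrite big_nat_recr //= lerDr sumr_ge0.
(* A single term of the potential is at most [phi], so [delta * phi <= 3^-1] keeps two thirds of
   each denominator and lets each term grow by a factor of at most 3/2. *)
have dn23 j : 2 / 3 * dn j <= dn' j.
  have := mu1 j; have := pos j; rewrite dnE -/(dn j) => p1 p2.
  have : delta * lam j <= 3^-1 * dn j.
    apply: (@le_trans _ _ (delta * (phi * dn j))); first by rewrite ler_pM2l.
    by rewrite mulrA ler_pM2r.
  lra.
have pos' j : 0 < dn' j.
  by apply: lt_le_trans (dn23 j); rewrite mulr_gt0 ?divr_gt0 //; exact: pos.
have mu'0 j : 0 <= mu' j by rewrite divr_ge0 // ltW.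
have mu32 j : mu' j <= 3 / 2 * (lam j / dn j).
  rewrite /mu' ler_pdivrMr //.
  have -> : 3 / 2 * (lam j / dn j) * dn' j = 3 / 2 * lam j * (dn' j / dn j) by ring.
  have : 2 / 3 <= dn' j / dn j by rewrite ler_pdivlMr.
  move: (dn' j / dn j) (lam0 j) => r; nra.
have sum32 n : \sum_(0 <= j < n) mu' j <= 3 / 2 * phi.
  apply: (@le_trans _ _ (3 / 2 * \sum_(0 <= j < n) lam j / dn j)).
    by rewrite mulr_sumr; apply: ler_sum.
  by apply: ler_wpM2l; [rewrite divr_ge0|exact: hphi].
(* Exactly, [mu' j] exceeds the old term by [delta] times the product of the old and the new
   term. *)
have rise j : mu' j <= lam j / dn j + delta * mu' j ^+ 2.
  have p1 := pos j; rewrite -/(dn j) in p1.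
  have muE : mu' j = lam j / dn j + delta * ((lam j / dn j) * mu' j).
    rewrite /mu'; have p2 := pos' j; rewrite dnE in p2 *.
    by field; rewrite !gt_eqF.
  rewrite {1}muE lerD2l ler_pM2l // expr2; apply: ler_wpM2r => //.
  by rewrite /mu' ler_wpM2l // lef_pV2 ?posrE // dnE gerBl mulr_ge0 // ltW.
pose E2 := range (fun n => \sum_(0 <= j < n) mu' j ^+ 2).
have hE2 : has_sup E2.
  split; first by exists 0, 0%N => //; rewrite big_geq.
  exists ((3 / 2 * phi) * (3 / 2 * phi)) => _ [n _ <-].
  apply: (@le_trans _ _ ((3 / 2 * phi) * \sum_(0 <= j < n) mu' j)).
    rewrite mulr_sumr; apply: ler_sum => j _; rewrite expr2 ler_wpM2r //.
    by apply: le_trans (sum32 j.+1); rewrite big_nat_recr //= lerDr sumr_ge0.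
  by apply: ler_wpM2l => //; rewrite mulr_ge0.
pose S2 : R := sup E2.
have S2ub n : \sum_(0 <= j < n) mu' j ^+ 2 <= S2.
  by apply: sup_upper_bound => //; exists n.
have S2p : 0 < S2.
  by apply: lt_le_trans (S2ub 1%N); rewrite big_nat1 exprn_gt0 // divr_gt0.
pose th := delta * S2.
have th0 : 0 < th by rewrite mulr_gt0.
have hphi' n : \sum_(0 <= j < n) mu' j <= phi + th.
  apply: (@le_trans _ _ (\sum_(0 <= j < n) (lam j / dn j + delta * mu' j ^+ 2))).
    by apply: ler_sum.
  rewrite big_split /= -mulr_sumr; apply: lerD; first exact: hphi.
  by rewrite ler_pM2l.
apply: contrapT => nox.
have [Z negZ hZ] := null_points.
pose t j x := sqn (ev (e j) x) / dn' j.
have key x : D x -> ~ Z x -> forall n b, (forall m, \sum_(0 <= j < m) t j x <= b) ->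
    \sum_(0 <= j < n) mu' j * t j x <= th * b.
  move=> Dx nZx; have [k [kd' _]] := kernel_section rk Dx.
  have kd g : ev g x = dotf g k by exact: kd'.
  have hk f : S f -> qf q f = 0 -> dotf f k = 0.
    by move=> _ f0; rewrite -kd; exact: hZ.
  have tE j : t j x = sqn (dotf k (e j)) / dn' j.
    by rewrite /t kd (hermC hd) sqn_conj.
  (* The barrier stands at [l + delta] already, with potential at most [phi + th]; a cut that
     removes [th] brings it back to [phi]. *)
  have := barrier_cut hH hq pq qT eps0 hS cS sp pos' hk th hphi'.
  case=> [good|cut n b hb].
    exfalso; apply: nox; exists x => // e' lam' sp'.
    have SE : S `&` [set f | dotf f k = 0] = S `&` [set f | ev f x = 0].
      by congr (_ `&` _); apply/funext => f /=; rewrite kd.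
    rewrite -SE in sp'; have [h1 h2] := good _ _ sp'; split => // n.
    by have := h2 n; rewrite addrK.
  under eq_bigr do rewrite tE; apply: cut => [m|]; last exact: ltW.
  by under eq_bigr do rewrite -tE; exact: hb.
have t0 j x : 0 <= t j x by rewrite divr_ge0 ?sqn_ge0 // ltW.
have mt j : measurable_fun D (EFin \o t j).
  have -> : EFin \o t j =
      (fun x => ((dn' j)^-1)%:E * (EFin \o (fun x => sqn (ev (e j) x))) x)%E.
    by apply/funext => x; rewrite /= -EFinM /t mulrC.
  by apply: emeasurable_funM => //; exact: measurable_evsq.
have intt j : (\int[mu]_(x in D) (t j x)%:E = (mu' j)%:E)%E.
  transitivity (\int[mu]_(x in D)
      (((dn' j)^-1)%:E * (EFin \o (fun x => sqn (ev (e j) x))) x))%E.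
    by apply: eq_integral => x _; rewrite /= -EFinM /t mulrC.
  rewrite ge0_integralZl //; last 3 first.
  - exact: measurable_evsq.
  - by move=> x _; rewrite lee_fin sqn_ge0.
  - by rewrite lee_fin invr_ge0 ltW.
  rewrite -[X in (_ * X)%E]/(sqint D mu (ev (e j))) -(qf_L2formE mD rk mev KT) -EFinM.
  by rewrite -/q (sp_qf sp) mulrC.
(* Integrating [key] gives at most [th] times the sum of the [mu' j], hence at most
   [delta * S2 * (3 / 2 * phi)], and [delta * phi <= 3^-1]. *)
have bound n : \sum_(0 <= j < n) mu' j ^+ 2 <= S2 / 2.
  have mF : measurable_fun D
      (fun x => \sum_(j <- index_iota 0 n) (mu' j)%:E * (t j x)%:E)%E.
    apply: emeasurable_sum => j; apply: emeasurable_funM => //; exact: mt.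
  have mG : measurable_fun D (fun x => \sum_(0 <= j <oo) (t j x)%:E)%E.
    apply: ge0_emeasurable_sum => // [j x _ _|j _]; [by rewrite lee_fin|exact: mt].
  have G0 x : (0 <= \sum_(0 <= j <oo) (t j x)%:E)%E.
    by apply: nneseries_ge0 => j _ _; rewrite lee_fin.
  have : (\int[mu]_(x in D) (\sum_(j <- index_iota 0 n) (mu' j)%:E * (t j x)%:E) <=
      \int[mu]_(x in D) (th%:E * \sum_(0 <= j <oo) (t j x)%:E))%E.
    apply: ae_ge0_le_integral => //.
    - by move=> x _; apply: sume_ge0 => j _; rewrite -EFinM lee_fin mulr_ge0.
    - by move=> x _; rewrite mule_ge0 // lee_fin ltW.
    - by apply: emeasurable_funM.
    apply: negligibleS negZ => x /= nle; apply: contrapT => nZx; apply: nle => Dx.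
    (* [key] takes a real bound [b]; where the series is infinite, the right-hand side is [+oo]
       because [th > 0]. *)
    have [Ginf|Gfin] := eqVneq (\sum_(0 <= j <oo) (t j x)%:E)%E +oo%E.
      by rewrite Ginf gt0_muley ?lte_fin // leey.
    have Gf : (\sum_(0 <= j <oo) (t j x)%:E)%E \is a fin_num.
      by rewrite ge0_fin_numE // ltey.
    under eq_bigr do rewrite -EFinM.
    rewrite sumEFin -(fineK Gf) -EFinM lee_fin; apply: key => // m.
    rewrite -lee_fin fineK // -sumEFin; apply: nneseries_lim_ge => j _ _.
    by rewrite lee_fin.
  rewrite ge0_integralZl //; last by rewrite lee_fin ltW.
  rewrite ge0_integral_sum //; last 2 first.
  - by move=> j; apply: emeasurable_funM => //; exact: mt.
  - by move=> j x _; rewrite -EFinM lee_fin mulr_ge0.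
  have -> : (\sum_(j <- index_iota 0 n) \int[mu]_(x in D) ((mu' j)%:E * (t j x)%:E) =
      (\sum_(0 <= j < n) mu' j ^+ 2)%:E)%E.
    rewrite -sumEFin; apply: eq_bigr => j _.
    rewrite ge0_integralZl ?lee_fin //; last 2 first.
    - exact: mt.
    - by move=> x _; rewrite lee_fin.
    by rewrite intt -EFinM expr2.
  rewrite integral_nneseries //; last by move=> j x _; rewrite lee_fin.
  move=> le1; rewrite -lee_fin; apply: le_trans le1 _.
  have : (\sum_(0 <= j <oo) \int[mu]_(x in D) (t j x)%:E <= (3 / 2 * phi)%:E)%E.
    apply: nneseries_le => [j _|N]; first by rewrite intt lee_fin.
    by under eq_bigr do rewrite intt; rewrite sumEFin lee_fin.
  move=> le2; apply: (@le_trans _ _ (th%:E * (3 / 2 * phi)%:E)%E).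
    by apply: lee_wpmul2l => //; rewrite lee_fin ltW.
  rewrite -EFinM lee_fin /th; nra.
have : S2 <= S2 / 2.
  by apply: ge_sup; [exact: hE2.1|move=> _ [n _ <-]; exact: bound].
lra.
Qed.

(** * Iteration over n points *)

Definition vanishing (xs : seq T) : set H :=
  [set f | forall x, x \in xs -> ev f x = 0].

Lemma vanishing_nil : vanishing [::] = setT.
Proof. by apply/seteqP; split. Qed.

Lemma vanishing_cons x xs :
  vanishing (x :: xs) = vanishing xs `&` [set f | ev f x = 0].
Proof.
apply/seteqP; split => f /=.
  by move=> h; split => [y ys|]; apply: h; rewrite inE ?ys ?orbT ?eqxx.
by move=> [h fx] y; rewrite inE => /orP[/eqP ->|/h].
Qed.

Lemma vanishing_subspace xs : subspace (vanishing xs).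
Proof.
split=> [x _|a f g f0 g0 x xs0]; first by rewrite linear0.
by rewrite ev_linear f0 // g0 // mulr0 addr0.
Qed.

Lemma vanishing_qclosed xs : (forall x, x \in xs -> D x) ->
  qclosed dotf (vanishing xs).
Proof.
move=> Dxs f fV x xxs; have [k [kd _]] := kernel_section rk (Dxs _ xxs).
rewrite kd; apply: (qclosed_ker hH (dot_bounded hH k)) => eps /fV[g gV fg].
by exists g => //=; rewrite -[LHS]kd gV.
Qed.

Lemma potential_iterate e lam (eps l delta phi : R) (n : nat) :
  D !=set0 -> spectral dotf q Tr setT e lam ->
  0 < eps -> 0 < delta -> 0 <= phi -> delta * phi <= 3^-1 ->
  (forall j, 0 < eps - l * lam j) ->
  (forall N, \sum_(0 <= j < N) lam j / (eps - l * lam j) <= phi) ->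
  exists xs, [/\ size xs = n, forall x, x \in xs -> D x &
    exists e' lam', [/\ spectral dotf q Tr (vanishing xs) e' lam',
      forall j, 0 < eps - (l + delta *+ n) * lam' j &
      forall N, \sum_(0 <= j < N) lam' j / (eps - (l + delta *+ n) * lam' j) <= phi]].
Proof.
move=> D0 sp eps0 delta0 phi0 dphi pos hphi; elim: n => [|n].
  exists [::]; split => //; exists e, lam; rewrite mulr0n addr0.
  by split => //; rewrite vanishing_nil.
move=> [xs [sxs Dxs [e1 [lam1 [sp1 pos1 hphi1]]]]].
have cS := vanishing_qclosed Dxs; have hS := vanishing_subspace xs.
have [x Dx hx] := potential_step D0 hS cS sp1 eps0 delta0 phi0 dphi pos1 hphi1.
have Dxxs y : y \in x :: xs -> D y by rewrite inE => /orP[/eqP ->|/Dxs].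
exists (x :: xs); split => //=; first by rewrite sxs.
have [e2 [lam2 sp2]] :=
  spectral_exists hH hq pq qT (vanishing_subspace (x :: xs)) (vanishing_qclosed Dxxs).
exists e2, lam2; rewrite mulrSr addrA.
have sp2' := sp2; rewrite vanishing_cons in sp2'.
by have [h1 h2] := hx _ _ sp2'; split.
Qed.

(** The step [2 / n] and the level [n / 6] have product 1/3, all that [potential_step] allows, and
    [n] steps lead from -1 to 1. There, positivity of the denominator at [j = 0] says that the
    largest remaining eigenvalue is below [eps]. *)
Lemma good_points e lam (eps : R) (n : nat) : (0 < n)%N -> D !=set0 ->
  spectral dotf q Tr setT e lam -> 0 < eps ->
  (forall N, \sum_(0 <= j < N) lam j / (eps + lam j) <= n%:R / 6) ->
  exists2 x : 'I_n -> T, (forall i, D (x i)) &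
    forall f, (forall i, ev f (x i) = 0) -> qf q f <= eps * qf dotf f.
Proof.
move=> n0 D0 sp eps0 hsum.
have nR : 0 < n%:R :> R by rewrite ltr0n.
have d0 : 0 < 2 / n%:R :> R by rewrite divr_gt0.
have p0 : 0 <= n%:R / 6 :> R by rewrite divr_ge0.
have dp : 2 / n%:R * (n%:R / 6) <= 3^-1 :> R.
  by rewrite le_eqVlt; apply/orP; left; apply/eqP; field; rewrite gt_eqF.
have dE j : eps - -1 * lam j = eps + lam j by rewrite mulN1r opprK.
have [|N|xs [sxs Dxs [e' [lam' [sp' pos' _]]]]] :=
    potential_iterate (l := -1) n D0 sp eps0 d0 p0 dp.
- by move=> j; rewrite dE ltr_wpDr // (sp_ge0 sp).
- by under eq_bigr do rewrite dE.
exists (fun i => tnth (Tuple (introT eqP sxs)) i).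
  by move=> i; apply: Dxs; exact: mem_tnth.
move=> f f0; have fV : vanishing xs f.
  by move=> x /(tnthP (Tuple (introT eqP sxs)))[i ->].
apply: le_trans (sp_max sp' (n := 0) fV _) _ => //.
apply: ler_wpM2r; first exact: pd.
have := pos' 0%N.
have -> : -1 + (2 / n%:R) *+ n = 1 :> R.
  by rewrite -mulr_natr -mulrA mulVf ?gt_eqF // mulr1; ring.
by rewrite mul1r subr_gt0 => /ltW.
Qed.

(** * From good points to sampling numbers *)

Lemma unit_ball (f : H) : `|f| <= 1 -> qf dotf f <= 1.
Proof.
rewrite (normr_dot rk) -[1 : R[i]]/((1 : R)%:C) lecR => f1.
by rewrite -[qf _ _]sqr_sqrtr ?pd // expr_le1 // sqrtr_ge0.
Qed.

Lemma sampling_le (n : nat) (x : 'I_n -> T) (eps : R) :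
  (forall i, D (x i)) ->
  (forall f, (forall i, ev f (x i) = 0) -> qf q f <= eps * qf dotf f) ->
  0 <= eps ->
  (sampling_number D ev mu n <= (Num.sqrt (4 * eps))%:E)%E.
Proof.
move=> Dx hx eps0.
(* The reconstruction must be defined on all of C^n: it is 0 on data that no function of the unit
   ball produces. *)
pose pick (v : 'rV[R[i]]_n) : H :=
  xget 0 [set f : H | `|f| <= 1 /\ forall i, ev f (x i) = v 0 i].
apply: le_trans (ereal_inf_lbound _) _; first by exists x.
apply: le_trans (ereal_inf_lbound _) _.
  exists (fun v => ev (pick v)) => //= v; split; first exact: mev.
  by rewrite (L2norm_ev mD rk mev KT) ltry.
apply: ge_ereal_sup => _ [f /= f1 <-].
set v := \row_i _.
have [g1 gx] : `|pick v| <= 1 /\ forall i, ev (pick v) (x i) = v 0 i.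
  by rewrite /pick; case: xgetP => [//|/(_ f)[]]; split => // i; rewrite mxE.
have -> : (fun z => ev f z - ev (pick v) z) = ev (f - pick v).
  by apply/funext => z; rewrite linearB.
rewrite (L2norm_ev mD rk mev KT) lee_fin; apply: ler_wsqrtr.
apply: le_trans (hx _ _) _.
  move=> i; have -> : ev (f - pick v) (x i) = ev f (x i) - ev (pick v) (x i).
    by rewrite linearB.
  by rewrite gx mxE subrr.
rewrite [leRHS]mulrC; apply: ler_wpM2l => //.
apply: le_trans (qfD_le2 hd (@subspaceT _ H) pd I I) _; rewrite qfN //.
by have := unit_ball f1; have := unit_ball g1; lra.
Qed.

Lemma sampling_ge0 n : (0 <= sampling_number D ev mu n)%E.
Proof.
apply: le_ereal_inf_tmp => _ [x _ <-]; apply: le_ereal_inf_tmp => _ [phi _ <-].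
apply: le_trans (ereal_sup_ubound _); last first.
  by exists 0 => //=; rewrite normr0 ler01.
exact: poweR_ge0.
Qed.

(** * The Hilbert-Schmidt property *)

Lemma exists_orthonormal_basis : exists E : set H, orthonormal_basis dot E.
Proof.
pose P (A : set H) := forall e e', A e -> A e' -> dot e e' = (e == e')%:R.
have [F FP Ftot|E [PE maxE]] := @Zorn_bigcup H P.
  move=> e e' [A FA Ae] [B FB Be'].
  by have [AB|BA] := Ftot _ _ FA FB; [apply: (FP B) => //; exact: AB|
    apply: (FP A) => //; exact: BA].
exists E; split => // f fE; apply/eqP/negPn/negP => f0.
have [r [g [_ g1 _ gE]]] := unit_scale hH f0.
have gO e : E e -> dotf g e = 0.
  by move=> Ee; rewrite gE hermZl // [dotf f e]fE // mulr0.
have gN : ~ E g.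
  by move=> /gO; rewrite g1 => /eqP; rewrite oner_eq0.
apply: (maxE (g |` E)).
  by split => [e Ee|h]; [right|apply: gN; apply: h; left].
move=> e e' [->|Ee] [->|Ee'].
- by rewrite eqxx; exact: g1.
- have -> : (g == e') = false by apply/eqP => h; apply: gN; rewrite h.
  exact: gO.
- have -> : (e == g) = false by apply/eqP => h; apply: gN; rewrite -h.
  exact: (herm_eq0C hd (gO _ Ee)).
- exact: PE.
Qed.

Lemma orthonormal_orthon s : uniq s ->
  (forall h h', h \in s -> h' \in s -> dotf h h' = (h == h')%:R) -> orthon dotf s.
Proof.
elim: s => //= h s ih /andP[hs us] hO; split.
- by left; rewrite hO ?inE ?eqxx.
- move=> g gs; rewrite hO ?inE ?eqxx ?gs ?orbT //.
  by case: eqP hs => // ->; rewrite gs.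
- by apply: ih => // a b as' bs; apply: hO; rewrite inE ?as' ?bs orbT.
Qed.

Lemma hilbert_schmidt : Id_hilbert_schmidt D dot ev mu.
Proof.
have L2E f := L2norm_ev mD rk mev KT f.
split.
- by move=> f; split; [exact: mev|rewrite L2E ltry].
- exists (Num.sqrt Tr) => f; rewrite L2E lee_fin (normr_dot rk) /=.
  rewrite -sqrtrM; last exact: (trace_ge0 qT).
  by apply: ler_wsqrtr; exact: (qf_le_trace hH hq qT).
have [E [Eo Ec]] := exists_orthonormal_basis; exists E; split => //.
apply: (@le_lt_trans _ _ Tr%:E); last exact: ltry.
apply: ge_ereal_sup => _ [A [finA AE] <-].
rewrite fsbig_finite //= (eq_bigr (fun e => (qf q e)%:E)); last first.
  by move=> e _; rewrite L2E -EFinM -expr2 sqr_sqrtr // pq.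
rewrite sumEFin lee_fin; apply: qT.
apply: orthonormal_orthon; first exact: finmap.fset_uniq.
by move=> h h'; rewrite !in_fset_set // => /set_mem/AE ? /set_mem/AE ?; exact: Eo.
Qed.

Lemma sampling_sq_le e lam (n : nat) (P : pred nat) (tau : R) :
  (0 < n)%N -> D !=set0 -> spectral dotf q Tr setT e lam ->
  (forall N, \sum_(0 <= j < N | P j) lam j <= tau) ->
  (forall j, ~~ P j -> j.+1%:R <= n%:R / 12 :> R) ->
  (sampling_number D ev mu n ^+ 2 <= (48 / n%:R * tau)%:E)%E.
Proof.
move=> n0 D0 sp htau hP.
have nR : 0 < n%:R :> R by rewrite ltr0n.
have lam0 := sp_ge0 sp.
have tau0 : 0 <= tau by have := htau 0%N; rewrite big_geq.
apply/lee_addgt0Pr => r r0.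
(* The summand [r / 4] keeps [eps] positive when [tau = 0]; in [4 * eps] it costs just the slack
   [r]. *)
pose eps := 12 / n%:R * tau + r / 4.
have eps0 : 0 < eps.
  by rewrite ltr_wpDl ?divr_gt0 // mulr_ge0 // divr_ge0 // ltW.
(* If [N] is the last index outside [P], there are at most [N + 1] such indices, and [hP] bounds
   [N + 1]. *)
have hcount N : \sum_(0 <= j < N | ~~ P j) (1 : R) <= n%:R / 12.
  elim: N => [|N ih]; first by rewrite big_geq // divr_ge0.
  have [PN|PN] := boolP (P N).
    by rewrite big_mkcond big_nat_recr //= PN /= addr0 -big_mkcond.
  apply: le_trans (hP _ PN); rewrite big_mkcond /=.
  apply: (@le_trans _ _ (\sum_(0 <= j < N.+1) (1 : R))).
    by apply: ler_sum => j _; case: ifP.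
  by rewrite sumr_const_nat subn0.
(* Terms outside [P] are bounded by 1, those in [P] by [lam j / eps]; each group contributes at most
   [n / 12]. *)
have hsum N : \sum_(0 <= j < N) lam j / (eps + lam j) <= n%:R / 6.
  have le1 j : lam j / (eps + lam j) <= 1.
    by rewrite ler_pdivrMr ?mul1r ?lerDr ?ltW // ltr_wpDr.
  have le2 j : lam j / (eps + lam j) <= lam j / eps.
    by rewrite ler_wpM2l // lef_pV2 ?posrE ?lerDl // ltr_wpDr.
  rewrite (bigID P) /=.
  apply: (@le_trans _ _ (\sum_(0 <= j < N | P j) lam j / eps +
      \sum_(0 <= j < N | ~~ P j) 1)).
    by apply: lerD; apply: ler_sum.
  rewrite -mulr_suml; have : (\sum_(0 <= j < N | P j) lam j) / eps <= n%:R / 12.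
    rewrite ler_pdivrMr //; apply: le_trans (htau N) _.
    have -> : n%:R / 12 * eps = tau + n%:R / 12 * (r / 4).
      by rewrite /eps; field; rewrite gt_eqF.
    by rewrite lerDl mulr_ge0 // divr_ge0 // ltW.
  have := hcount N; lra.
have [x Dx hx] := good_points n0 D0 sp eps0 hsum.
have le := sampling_le Dx hx (ltW eps0).
have s0 := sampling_ge0 n.
apply: (@le_trans _ _ ((Num.sqrt (4 * eps))%:E ^+ 2)%E).
  by rewrite !expe2; apply: lee_pmul.
rewrite -EFin_expe sqr_sqrtr; last by rewrite mulr_ge0 // ltW.
by rewrite -EFinD lee_fin /eps; lra.
Qed.

End sampling.

(* R^d is [d.-tuple R] with its product (Borel) sigma-algebra. *)
Theorem theorem6p1 (R : realType) :
  exists C c : R, 0 < C /\ 0 < c /\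
  forall (d : nat) (D : set (d.-tuple R))
    (rho : {measure set (d.-tuple R) -> \bar R})
    (K : d.-tuple R -> d.-tuple R -> complex R)
    (H : completeNormedModType (complex R)) (dot : {dot H for Num.conj})
    (ev : {linear H -> (d.-tuple R -> complex R)}),
  measurable D ->
  psd_kernel D K ->
  rkhs D dot ev K ->
  separable_space H ->
  infinite_dim H ->
  (forall f : H, cmeasurable D (ev f)) ->
  (\int[rho]_(x in D) (complex.Re (K x x))%:E < +oo)%E ->
  Id_hilbert_schmidt D dot ev rho /\
  (exists sigma : nat -> R, Id_singular_numbers D dot ev rho sigma) /\
  forall sigma : nat -> R, Id_singular_numbers D dot ev rho sigma ->
    (\sum_(0 <= j <oo) (sigma j ^+ 2)%:E < +oo)%E /\
    forall n : nat, (2 <= n)%N ->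
      (sampling_number D ev rho n ^+ 2 <=
        (C * (ln n%:R / n%:R))%:E *
        \sum_(0 <= j <oo | (c * n%:R <= j.+1%:R)%R) (sigma j ^+ 2)%:E)%E.
Proof.
have ln2 : 0 < ln 2 :> R by rewrite ln_gt0 // ltr1n.
(* The bound [48 / n] is weakened to the stated one by [ln 2 <= ln n]. *)
exists (48 / ln 2), 12^-1; split; first by rewrite divr_gt0.
split; first by rewrite invr_gt0.
move=> d D rho K H dot ev mD _ rk sepH infH mev KT.
(* Over an empty [D] every element of [H] would be 0, against infinite dimension. *)
have D0 : D !=set0.
  apply/set0P/eqP => DE; apply: (infH 0%N).
  have [_ inj _] := rk; have H0 (f : H) : f = 0 by apply: inj => x; rewrite DE.
  exists (fun _ => 0); split => [a _ []//|].
  apply/seteqP; split => // f _; exists (fun _ => 0) => //.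
  by rewrite big_ord0 (H0 f).
pose q := L2form D rho ev; pose Tr := trace_bound D rho K.
have hH := dot_hilbert rk.
have hq : herm q := L2form_herm mD rk mev KT.
have pq : psd_on setT q := @L2form_psd _ _ _ D rho _ ev.
have qT := L2form_trace mD rk mev KT.
have [e [lam sp]] := spectral_exists hH hq pq qT (@subspaceT _ H) (fun f _ => I).
(* [adjoint_exists] guarantees that the description in [Id_adjoint] is met and its default 0 not
   taken. *)
have hW (f g : H) : dot g (Id_adjoint D dot ev rho (ev f)) = q g f.
  rewrite /Id_adjoint; case: xgetP => [h -> hP|none]; first exact: hP.
  by have [h hh] := adjoint_exists hH hq pq qT f sp; case: (none h hh).
have sing := spectral_singular hH hq pq qT sp hW.
have lam0 := sp_ge0 sp.
split; first exact: hilbert_schmidt mD rk mev KT.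
split; first by exists (fun j => Num.sqrt (lam j)).
move=> sigma hsigma.
(* An arbitrary sequence of singular numbers is identified with the constructed one by
   uniqueness. *)
have s2 j : sigma j ^+ 2 = lam j.
  by rewrite (singular_numbers_uniq hsigma sing) sqr_sqrtr.
have sum_le (P : pred nat) :
    (\sum_(0 <= j <oo | P j) (sigma j ^+ 2)%:E <= Tr%:E)%E.
  apply: nneseries_le => [j _|N]; first by rewrite lee_fin sqr_ge0.
  under eq_bigr do rewrite s2.
  rewrite sumEFin lee_fin; apply: le_trans (sp_sum sp N).
  by rewrite big_mkcond; apply: ler_sum => j _; case: ifP.
split; first by apply: le_lt_trans (sum_le xpredT) _; exact: ltry.
(* Index [j] stands for [k = j + 1], so the indices outside [P] are those with [k < n / 12]. *)
move=> n n2; pose P j := (12^-1 * n%:R <= j.+1%:R :> R).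
rewrite -[X in (_ * X)%E]/(\sum_(0 <= j <oo | P j) (sigma j ^+ 2)%:E)%E.
set E := (\sum_(0 <= j <oo | P j) _)%E.
have E0 : (0 <= E)%E by apply: nneseries_ge0 => j _ _; rewrite lee_fin sqr_ge0.
have Ef : E \is a fin_num.
  by rewrite ge0_fin_numE //; apply: le_lt_trans (sum_le P) _; exact: ltry.
have n0 : (0 < n)%N by apply: leq_trans n2.
have htau N : \sum_(0 <= j < N | P j) lam j <= fine E.
  rewrite -lee_fin fineK // -sumEFin.
  under eq_bigr do rewrite -s2.
  by apply: nneseries_lim_ge => j _ _; rewrite lee_fin sqr_ge0.
have hP j : ~~ P j -> j.+1%:R <= n%:R / 12 :> R.
  by rewrite /P -ltNge mulrC => /ltW.
apply: le_trans (sampling_sq_le mD rk mev KT sepH n0 D0 sp htau hP) _.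
rewrite -[X in (_ <= _ * X)%E](fineK Ef) -EFinM lee_fin.
apply: ler_wpM2r; first exact: fine_ge0.
have nR : 0 < n%:R :> R by rewrite ltr0n.
rewrite mulrA ler_pM2r ?invr_gt0 // mulrAC ler_pdivlMr // ler_pM2l //.
by rewrite ler_ln ?posrE // ler_nat.
Qed.
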